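(* Let $N=T/L$ be a positive integer and consider the observations $$\mathbf Y(f)=\mathbf G_{\mathcal S}(\boldsymbol\phi)\,\overline{\mathbf S}^{\mathcal S}(f)+\mathbf w(f)\in\mathbb C^{MP},\qquad f=1,\dots,N,$$ where $\mathbf G_{\mathcal S}(\boldsymbol\phi)=\mathbf A(\boldsymbol\phi)*\mathbf B_\Omega$ ($\Omega$ known), the vectors $\overline{\mathbf S}^{\mathcal S}(f)\in\mathbb C^K$ are deterministic and unknown, $\boldsymbol\phi=[\phi_1,\dots,\phi_K]\in\mathbb R^K$ is unknown, and the $\mathbf w(f)$ are independent zero-mean circularly symmetric complex Gaussian vectors with covariance $\sigma^2\mathbf I_{MP}$. Let $\mathbf R_{\overline{\mathbf S}}=\frac1N\sum_{f=1}^{N}\overline{\mathbf S}^{\mathcal S}(f)\,\overline{\mathbf S}^{\mathcal S}(f)^{\mathrm H}$, let $\mathbf E=[\mathbf E_1,\dots,\mathbf E_K]$ where $\mathbf E_i$ is the derivative of the $i$th column of $\mathbf G_{\mathcal S}$ with respect to $\phi_i$, and let $\mathbf P_{\mathbf G_{\mathcal S}}=\mathbf I-\mathbf G_{\mathcal S}\mathbf G_{\mathcal S}^{\dagger}$ with $\mathbf G_{\mathcal S}^\dagger=(\mathbf G_{\mathcal S}^{\mathrm H}\mathbf G_{\mathcal S})^{-1}\mathbf G_{\mathcal S}^{\mathrm H}$. Assume $\mathbf G_{\mathcal S}$ has full column rank and that $\Re\big((\mathbf E^{\mathrm H}\mathbf P_{\mathbf G_{\mathcal S}}\mathbf E)\odot\mathbf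 R_{\overline{\mathbf S}}^{\mathrm H}\big)$ is invertible. Then the Cram\'er--Rao bound on the covariance matrix of any unbiased estimator of $\boldsymbol\phi$ is $$\mathrm{CRB}_{sub}=\frac{\sigma^2}{2T/L}\Big(\Re\big((\mathbf E^{\mathrm H}\mathbf P_{\mathbf G_{\mathcal S}}\mathbf E)\odot\mathbf R_{\overline{\mathbf S}}^{\mathrm H}\big)\Big)^{-1},$$ and, writing $\mathbf R_{\mathbf S}=\frac1L\mathbf R_{\overline{\mathbf S}}$, this equals $$\frac{\sigma^2}{2T}\Big(\Re\big((\mathbf E^{\mathrm H}\mathbf P_{\mathbf G_{\mathcal S}}\mathbf E)\odot\mathbf R_{\mathbf S}^{\mathrm H}\big)\Big)^{-1}.$$
   Context: Notation: $j=\sqrt{-1}$; $\odot$ is the Hadamard (entrywise) product; $*$ is the Khatri--Rao (column-wise Kronecker) product; $\Re$ is the entrywise real part; $(\cdot)^{\mathrm H}$ is conjugate transpose. Array: $M$ sensors and $K<M$ signals. $\mathbf A(\boldsymbol\phi)=[\mathbf a(\phi_1),\dots,\mathbf a(\phi_K)]\in\mathbb C^{M\times K}$ with steering vector $\mathbf a(\phi)=[\exp(j\phi p_1),\dots,\exp(j\phi p_M)]^{\mathrm T}$ for fixed real sensor positions $p_1,\dots,p_M$ (for a uniform linear array $p_m=m-1$). Sub-Nyquist (multi-coset) sampling: integers $1\le P\le L$ and a sampling pattern of integers $0\le c_1<c_2<\dots<c_P\le L-1$. $\mathbf B\in\mathbb C^{P\times L}$ has entries $B_{il}=\frac1{\sqrt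 L}\exp\!\big(j\frac{2\pi}{L}c_i l\big)$, $1\le l\le L$. $\Omega=[l_1,\dots,l_K]$ is a list of distinct indices in $\{1,\dots,L\}$ (the sub-bands occupied by the $K$ signals), and $\mathbf B_\Omega$ is the $P\times K$ matrix whose $k$th column is the $l_k$th column of $\mathbf B$. The Cram\'er--Rao bound on $\boldsymbol\phi$ means the $K\times K$ block, corresponding to $\boldsymbol\phi$, of the inverse of the Fisher information matrix for all the unknown real parameters: $\sigma^2$, the real and imaginary parts of all $\overline{\mathbf S}^{\mathcal S}(f)$, and $\boldsymbol\phi$.
   Formalization: The conjugate transposes of R_Sbar and R_S in the Hadamard products (hypothesis and both formulas) are replaced by plain transposes, since the printed formula fails for K ≥ 2 when the off-diagonal entries have nonzero imaginary parts. *)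

(* Defs.v *)
From HB Require Import structures.
From mathcomp Require Import all_boot all_order all_algebra.
From mathcomp Require Export complex mxtens.
From mathcomp Require Import all_classical all_reals all_analysis.

Set Implicit Arguments.
Unset Strict Implicit.
Unset Printing Implicit Defensive.

Import Order.TTheory GRing.Theory Num.Theory.
Import numFieldNormedType.Exports.

Local Open Scope classical_set_scope.
Local Open Scope ring_scope.
Local Open Scope complex_scope.
Local Open Scope sesquilinear_scope.

Definition expi (R : realType) (x : R) : R[i] := cos x +i* sin x.

Definition hadamard (R : pzSemiRingType) (m n : nat) (A B : 'M[R]_(m, n)) :
  'M[R]_(m, n) := map2_mx *%R A B.

Definition khatri_rao (R : pzSemiRingType) (m p n : nat)
    (A : 'M[R]_(m, n)) (B : 'M[R]_(p, n)) : 'M[R]_(m * p, n) :=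
  \matrix_(i, k) (A (mxtens_unindex i).1 k * B (mxtens_unindex i).2 k).

(* The columns of [khatri_rao] are Kronecker products in the sense of [*t]. *)
Lemma khatri_raoE (R : pzRingType) (m p n : nat)
    (A : 'M[R]_(m, n)) (B : 'M[R]_(p, n)) i k :
  khatri_rao A B i k = (col k A *t col k B) i (mxtens_index (ord0, ord0)).
Proof. by rewrite /khatri_rao /tensmx !mxE. Qed.

Definition gram_pinv (R : realType) (m n : nat) (G : 'M[R[i]]_(m, n)) :
  'M[R[i]]_(n, m) := invmx ((G ^t*) *m G) *m (G ^t*).

(* The projection onto the orthogonal complement of the column space of G. *)
Definition proj_perp (R : realType) (m n : nat) (G : 'M[R[i]]_(m, n)) :
  'M[R[i]]_m := 1%:M - G *m gram_pinv G.

Definition Remx (R : realType) (m n : nat) (A : 'M[R[i]]_(m, n)) :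
  'M[R]_(m, n) := map_mx (@complex.Re R) A.

Definition Immx (R : realType) (m n : nat) (A : 'M[R[i]]_(m, n)) :
  'M[R]_(m, n) := map_mx (@complex.Im R) A.

(* Partial derivative, in the k-th real variable, of a complex-valued map. *)
Definition cpartial (R : realType) (n : nat) (k : 'I_n)
    (g : 'rV[R]_n -> R[i]) (x : 'rV[R]_n) : R[i] :=
  'D_(delta_mx 0 k) (fun t => complex.Re (g t)) x
  +i* 'D_(delta_mx 0 k) (fun t => complex.Im (g t)) x.

Section array.
Context (R : realType) (M K : nat).
Implicit Types (p : 'I_M -> R) (phi : 'rV[R]_K).

Definition steering p (x : R) : 'cV[R[i]]_M := \col_m expi (x * p m).

Definition array_mx p phi : 'M[R[i]]_(M, K) :=
  \matrix_(m, k) steering p (phi 0 k) m 0.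

(* Columns are numbered 1, ..., L in the formula and 0, ..., L - 1 in 'I_L. *)
Definition coset_mx (P L : nat) (c : 'I_P -> nat) : 'M[R[i]]_(P, L) :=
  \matrix_(i, l) (((Num.sqrt L%:R)^-1)%:C
                  * expi (2 * pi / L%:R * (c i)%:R * l.+1%:R)).

Definition mixing_mx (P : nat) p (BOmega : 'M[R[i]]_(P, K)) phi :
  'M[R[i]]_(M * P, K) := khatri_rao (array_mx p phi) BOmega.

Definition dmixing_mx (P : nat) p (BOmega : 'M[R[i]]_(P, K)) phi :
  'M[R[i]]_(M * P, K) :=
  \matrix_(m, k) cpartial k (fun t => mixing_mx p BOmega t m k) phi.

End array.

Definition sample_cov (R : realType) (K N : nat) (S : 'I_N -> 'cV[R[i]]_K) :
  'M[R[i]]_K := N%:R^-1 *: \sum_(f < N) (S f *m ((S f) ^t*)).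

Section random_vectors.
Context (R : realType) (d : measure_display) (T : measurableType d)
  (Pr : probability T R).

(* C^n seen as R^(2n); its Borel sets are the product sigma-algebra of tuples. *)
Definition reim (n : nat) (z : 'cV[R[i]]_n) : (n + n).-tuple R :=
  cat_tuple (mktuple (fun i => complex.Re (z i 0)))
            (mktuple (fun i => complex.Im (z i 0))).

Definition random_cvec (n : nat) (Z : T -> 'cV[R[i]]_n) : Prop :=
  measurable_fun setT (fun t => reim (Z t)).

Definition cexpectation (X : T -> R[i]) : R[i] :=
  fine 'E_Pr[fun t => complex.Re (X t)]
  +i* fine 'E_Pr[fun t => complex.Im (X t)].

(* Constants are Gaussian; [normal_prob m s] has standard deviation s. *)
Definition gaussian (X : T -> R) : Prop :=
  (exists m : R, Pr (X @^-1` [set m]) = 1%E) \/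
  (exists m s : R, 0 < s /\
    forall A : set R, measurable A -> Pr (X @^-1` A) = normal_prob m s A).

(* Re (u^H Z) ranges over the real linear combinations of the real and
   imaginary parts of the entries of Z. *)
Definition complex_gaussian (n : nat) (Z : T -> 'cV[R[i]]_n) : Prop :=
  random_cvec Z /\
  forall u : 'cV[R[i]]_n,
    gaussian (fun t => complex.Re (((u ^t*) *m Z t) 0 0)).

Definition circularly_symmetric (n : nat) (Z : T -> 'cV[R[i]]_n) : Prop :=
  forall (a : R) (A : set ((n + n).-tuple R)), measurable A ->
    Pr [set t | A (reim (expi a *: Z t))] = Pr [set t | A (reim (Z t))].

Definition zero_mean (n : nat) (Z : T -> 'cV[R[i]]_n) : Prop :=
  forall i, cexpectation (fun t => Z t i 0) = 0.

(* E[Z Z^H], the covariance matrix of a zero-mean vector. *)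
Definition covariance_mx (n : nat) (Z : T -> 'cV[R[i]]_n) : 'M[R[i]]_n :=
  \matrix_(i, j) cexpectation (fun t => (Z t *m ((Z t) ^t*)) i j).

(* Taking A f = setT for some f gives the product rule for subfamilies. *)
Definition independent_cvecs (n N : nat) (Z : 'I_N -> T -> 'cV[R[i]]_n) :
    Prop :=
  forall A : 'I_N -> set ((n + n).-tuple R), (forall f, measurable (A f)) ->
    Pr [set t | forall f, A f (reim (Z f t))]
    = (\prod_(f < N) Pr [set t | A f (reim (Z f t))])%E.

End random_vectors.

(* Density, with respect to the Lebesgue measure of R^(2n), of the circularly
   symmetric complex Gaussian law with mean mu and covariance Gamma > 0. *)
Definition cgauss_pdf (R : realType) (n : nat) (mu : 'cV[R[i]]_n)
    (Gamma : 'M[R[i]]_n) (y : 'cV[R[i]]_n) : R :=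
  (complex.Re (\det (pi%:C *: Gamma)))^-1
  * expR (- complex.Re ((((y - mu) ^t*) *m invmx Gamma *m (y - mu)) 0 0)).

(* lik theta is the density of the observation Y when the parameter is theta;
   the expectation is under the law of Y at the parameter theta. *)
Definition fisher_information (R : realType) (d : measure_display)
    (T : measurableType d) (Pr : probability T R) (Obs : Type) (n : nat)
    (lik : 'rV[R]_n -> Obs -> R) (Y : T -> Obs) (theta : 'rV[R]_n) :
    'M[R]_n :=
  let score i y := 'D_(delta_mx 0 i) (fun t => ln (lik t y)) theta in
  \matrix_(i, j) fine 'E_Pr[fun t => score i (Y t) * score j (Y t)].

(* Real parameter vector: sigma^2, then the real parts and the imaginary parts
   of S(1), ..., S(N), then phi. *)
Section parameters.
Context (R : realType) (K N : nat).

Definition nparam : nat := (1 + (K * N + K * N)) + K.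

Definition pack (s2 : R) (S : 'I_N -> 'cV[R[i]]_K) (phi : 'rV[R]_K) :
    'rV[R]_nparam :=
  let Smx : 'M[R[i]]_(K, N) := \matrix_(k, f) S f k 0 in
  row_mx (row_mx (s2%:M : 'rV[R]_1)
                 (row_mx (mxvec (Remx Smx)) (mxvec (Immx Smx)))) phi.

Definition param_var (theta : 'rV[R]_nparam) : R :=
  (lsubmx (lsubmx theta) : 'rV[R]_1) 0 0.

Definition param_sig (theta : 'rV[R]_nparam) (f : 'I_N) : 'cV[R[i]]_K :=
  let ri := rsubmx (lsubmx theta) : 'rV[R]_(K * N + K * N) in
  \col_k ((vec_mx (lsubmx ri) : 'M[R]_(K, N)) k f
          +i* (vec_mx (rsubmx ri) : 'M[R]_(K, N)) k f).

Definition param_phi (theta : 'rV[R]_nparam) : 'rV[R]_K := rsubmx theta.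

Lemma param_var_pack s2 S phi : param_var (pack s2 S phi) = s2.
Proof. by rewrite /param_var /pack !row_mxKl !mxE eqxx mulr1n. Qed.

Lemma param_sig_pack s2 S phi : param_sig (pack s2 S phi) = S.
Proof.
apply/funext => f; apply/matrixP => k j; rewrite (ord1 j) /param_sig /pack.
rewrite mxE row_mxKl row_mxKr row_mxKl row_mxKr !mxvecK !mxE.
by case: (S f k 0).
Qed.

Lemma param_phi_pack s2 S phi : param_phi (pack s2 S phi) = phi.
Proof. by rewrite /param_phi /pack row_mxKr. Qed.

End parameters.

(* Joint density of the independent Y(f) ~ CN(G(phi) S(f), sigma^2 I). *)
Definition likelihood (R : realType) (M K P N : nat) (p : 'I_M -> R)
    (BOmega : 'M[R[i]]_(P, K)) (theta : 'rV[R]_(nparam K N))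
    (Y : 'I_N -> 'cV[R[i]]_(M * P)) : R :=
  \prod_(f < N)
    cgauss_pdf (mixing_mx p BOmega (param_phi theta) *m param_sig theta f)
               ((param_var theta)%:C%:M) (Y f).

(* The block of F^-1 that corresponds to phi. *)
Definition crb_phi (R : realType) (K N : nat) (F : 'M[R]_(nparam K N)) :
  'M[R]_K := drsubmx (invmx F : 'M[R]_((1 + (K * N + K * N)) + K)).

(* Main.v *)
Require Import Defs.
From HB Require Import structures.
From mathcomp Require Import all_boot all_order all_algebra.
From mathcomp Require Import all_classical all_reals all_analysis.
From mathcomp Require Import measurable_realfun ring lra.

Set Implicit Arguments.
Unset Strict Implicit.
Unset Printing Implicit Defensive.

Import Order.TTheory GRing.Theory Num.Theory.
Import numFieldNormedType.Exports.

Local Open Scope classical_set_scope.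
Local Open Scope ring_scope.
Local Open Scope complex_scope.
Local Open Scope sesquilinear_scope.

(** At the true parameter the derivative of the log-likelihood in the real
    direction [h = (v, s, psi)] is
      [v q(w) + (2 / sigma2) * \sum_f Re (J_h(f)^H w(f))],
    where [q(w)] is affine in the total noise energy [\sum_f |w(f)|^2] and
    [J_h(f) = G s(f) + E diag(psi) S(f)].  Circular symmetry (rotations by pi
    and pi / 2) and independence make the odd moments of the noise components
    vanish and their second moments equal to sigma2 / 2, so the Fisher
    information is the quadratic form
      [kappa v v' + (2 / sigma2) * \sum_f Re (J_h(f)^H J_h'(f))]
    with [kappa = E(q^2)].  Gaussian tails give [kappa > 0].  The direction
    [z_psi = (0, - G^+ E diag(psi) S, psi)] has [J(f) = PG E diag(psi) S(f)],
    orthogonal to the columns of [G]; pairing it with [h'] therefore only sees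
    the component [psi'], through [2 N / sigma2] times the matrix [H]
    to be inverted.  When [psi] runs through the rows of
    [sigma2 / (2 N) * H^-1], the [z_psi] are the last [K] rows of the inverse
    of the information matrix. *)

(** * Moments and tails of Gaussian laws *)

Section normal_moments.
Context (R : realType).
Implicit Types m s x : R.
Local Notation leb := (@lebesgue_measure R).

(** The Radon-Nikodym derivative of the Gaussian law and [normal_pdf] have the same integral over
    every measurable set, hence agree almost everywhere. *)
Lemma ge0_integral_normal_prob m s (f : R -> \bar R) :
  (forall x, (0 <= f x)%E) -> measurable_fun [set: R] f ->
  (\int[normal_prob m s]_x f x = \int[leb]_x (f x * (normal_pdf m s x)%:E))%E.
Proof.
move=> f0 mf.
have dom := normal_prob_dominates m s.
rewrite -(Radon_Nikodym_SigmaFinite.change_of_variables dom)//.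
have mD := measurable_int _ (Radon_Nikodym_SigmaFinite.f_integrable dom).
have mp : measurable_fun [set: R] (EFin \o normal_pdf m s).
  by apply/measurable_EFinP; exact: measurable_normal_pdf.
apply: ae_eq_integral => //.
- exact: emeasurable_funM.
- exact: emeasurable_funM.
apply: ae_eqe_mul2l.
apply: integral_ae_eq => //.
- exact: Radon_Nikodym_SigmaFinite.f_integrable.
- move=> A _ mA.
  by rewrite -Radon_Nikodym_SigmaFinite.f_integral.
Qed.

(** Doubling the standard deviation slows the exponential decay enough to absorb a polynomial of
    degree four; this supplies an integrable majorant for the fourth moment. *)
Lemma normal_pdf_mul_pow4 m s x : 0 < s ->
  x ^+ 4 * normal_pdf m s x <=
    (8 * (64 * s ^+ 4) + 8 * m ^+ 4) * (normal_peak s / normal_peak (2 * s))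
    * normal_pdf m (2 * s) x.
Proof.
move=> s0; have s2 : 0 < 2 * s by rewrite mulr_gt0.
rewrite !normal_pdfE ?gt_eqF// /normal_fun.
(* With this scaling the two exponents are [- 4 y] and [- y], so everything is expressed through
   [z = expR y]. *)
set y := (x - m) ^+ 2 / (8 * s ^+ 2).
have y0 : 0 <= y by rewrite divr_ge0 ?sqr_ge0// mulr_ge0 ?sqr_ge0.
have -> : - (x - m) ^+ 2 / (s ^+ 2 *+ 2) = - (4%:R * y).
  by rewrite /y; field; rewrite gt_eqF.
have -> : - (x - m) ^+ 2 / ((2 * s) ^+ 2 *+ 2) = - y.
  by rewrite /y; field; rewrite gt_eqF.
rewrite !expRN expRM_natl.
have zy := expR_ge1Dx y; set z := expR y in zy *.
have z1 : 1 <= z by rewrite (le_trans _ zy)// lerDl.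
have z0 : 0 < z by rewrite (lt_le_trans ltr01).
have xm : (x - m) ^+ 4 = 64 * s ^+ 4 * y ^+ 2.
  by rewrite /y; field; rewrite gt_eqF.
have x4 : x ^+ 4 <= 8 * (x - m) ^+ 4 + 8 * m ^+ 4.
  have h : x ^+ 2 <= 2 * ((x - m) ^+ 2 + m ^+ 2).
    rewrite -subr_ge0 (_ : _ - _ = (x - 2 * m) ^+ 2) ?sqr_ge0//; ring.
  have h' : (x ^+ 2) ^+ 2 <= (2 * ((x - m) ^+ 2 + m ^+ 2)) ^+ 2.
    by rewrite ler_sqr// nnegrE ?sqr_ge0// mulr_ge0// addr_ge0// sqr_ge0.
  rewrite -exprM in h'; apply: (le_trans h'); rewrite -subr_ge0.
  rewrite (_ : _ - _ = 4 * ((x - m) ^+ 2 - m ^+ 2) ^+ 2); last by ring.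
  by rewrite mulr_ge0 ?sqr_ge0.
(* From [1 + y <= z] one gets [y ^ 2 <= z ^ 2 <= z ^ 3]. *)
have y4 : y ^+ 2 * (z ^+ 4)^-1 <= z^-1.
  rewrite ler_pdivrMr ?exprn_gt0// (_ : z ^-1 * z ^+ 4 = z ^+ 3); last first.
    by field; rewrite gt_eqF.
  apply: (@le_trans _ _ (z ^+ 2)); last by rewrite ler_weXn2l.
  by rewrite ler_sqr ?nnegrE ?(ltW z0)// (le_trans _ zy)// lerDr.
have z4 : (z ^+ 4)^-1 <= z^-1.
  by rewrite lef_pV2 ?posrE ?exprn_gt0// -{1}(expr1 z) ler_weXn2l.
have p0 : 0 <= normal_peak s by exact: normal_peak_ge0.
have q0 : 0 < normal_peak (2 * s) by rewrite normal_peak_gt0// gt_eqF.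
move: (normal_peak s) (normal_peak (2 * s)) p0 q0 => p q p0 q0.
clearbody z.
rewrite [leRHS](_ : _ = p * ((8 * (64 * s ^+ 4) + 8 * m ^+ 4) * z^-1)); last first.
  by field; rewrite !gt_eqF.
rewrite mulrCA ler_wpM2l//.
apply: (@le_trans _ _ ((8 * (x - m) ^+ 4 + 8 * m ^+ 4) * (z ^+ 4)^-1)).
  by rewrite ler_wpM2r// invr_ge0 exprn_ge0// ltW.
rewrite xm [leLHS]mulrDl [leRHS]mulrDl; apply: lerD; last first.
  by rewrite ler_wpM2l// mulr_ge0 ?ler0n// exprn_even_ge0.
rewrite (_ : 8 * _ * _ = 8 * (64 * s ^+ 4) * (y ^+ 2 * (z ^+ 4)^-1)).
  by rewrite ler_wpM2l// mulr_ge0 ?ler0n// mulr_ge0 ?ler0n// exprn_even_ge0.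
by rewrite !mulrA.
Qed.

Lemma normal_prob_moment4 m s : 0 < s ->
  (\int[normal_prob m s]_x (x ^+ 4)%:E < +oo)%E.
Proof.
move=> s0.
rewrite ge0_integral_normal_prob; last 2 first.
- by move=> x; rewrite lee_fin exprn_even_ge0.
- by apply/measurable_EFinP; exact: measurable_funX.
set C := (8 * (64 * s ^+ 4) + 8 * m ^+ 4) * (normal_peak s / normal_peak (2 * s)).
apply: (@le_lt_trans _ _ (\int[leb]_x (C%:E * (normal_pdf m (2 * s) x)%:E))%E).
  apply: ge0_le_integral => //.
  - by move=> x _; rewrite mule_ge0// lee_fin ?exprn_even_ge0 ?normal_pdf_ge0.
  - apply/measurable_EFinP/measurable_funM; first exact: measurable_funX.
    exact: measurable_normal_pdf.
  - apply/measurable_EFinP/measurable_funM => //.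
    exact: measurable_normal_pdf.
  - by move=> x _; rewrite -!EFinM lee_fin; exact: normal_pdf_mul_pow4.
rewrite integralZl//; last exact: integrable_normal_pdf.
by rewrite integral_normal_pdf mule1 ltry.
Qed.

(** A null tail would make the density vanish almost everywhere on [[c, +oo[], but it is strictly
    positive on [[c, c + 1]], which has Lebesgue measure one. *)
Lemma normal_prob_tail_gt0 m s (c : R) : 0 < s ->
  (0 < normal_prob m s [set x : R | (c <= x)%R])%E.
Proof.
move=> s0.
have mA : measurable [set x : R | (c <= x)%R].
  have -> : [set x : R | (c <= x)%R] = `[c, +oo[%classic.
    by apply/seteqP; split=> x /=; rewrite in_itv/= andbT.
  exact: measurable_itv.
rewrite lt_neqAle measure_ge0 andbT eq_sym; apply/negP => /eqP h.
have : ae_eq leb [set x : R | (c <= x)%R] (EFin \o normal_pdf m s) (cst 0%E).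
  apply/ae_eq_integral_abs => //.
    by apply/measurable_EFinP/measurable_funTS; exact: measurable_normal_pdf.
  rewrite -[RHS]h; apply: eq_integral => x _.
  by rewrite /= ger0_norm// normal_pdf_ge0.
move=> [B [mB B0 sub]].
pose I : set R := `[c, c + 1]%classic.
have : (leb I <= leb B)%E.
  apply: le_measure; rewrite ?inE//; [exact: measurable_itv|].
  apply: (subset_trans _ sub) => x; rewrite /I /= in_itv/= => /andP[cx _] /(_ cx)/eqP; apply/negP.
  rewrite eqe normal_pdfE ?gt_eqF// mulr_gt0 ?expR_gt0//.
  by rewrite normal_peak_gt0// gt_eqF.
rewrite B0 lebesgue_measure_itv/= lte_fin ltrDl ltr01 -EFinB addrAC subrr add0r.
by rewrite lee_fin ler10.
Qed.

End normal_moments.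

(** * Expectations depend only on the law *)

Section same_law.
Context (R : realType) d (T : measurableType d) (P : probability T R).
Context d' (U : measurableType d').

(** Splitting [g] into positive and negative parts reduces to nonnegative functions, whose integrals
    are integrals against the common pushforward measure. *)
Lemma expectation_same_law (X Y : T -> U) (g : U -> R) :
  measurable_fun setT X -> measurable_fun setT Y -> measurable_fun setT g ->
  (forall A, measurable A -> P (X @^-1` A) = P (Y @^-1` A)) ->
  ('E_P[g \o X] = 'E_P[g \o Y])%E.
Proof.
move=> mX mY mg XY.
have main (f : U -> \bar R) : (forall y, (0 <= f y)%E) ->
    measurable_fun setT f -> (\int[P]_t (f \o X) t = \int[P]_t (f \o Y) t)%E.
  move=> f0 mf.
  have := @ge0_integral_pushforward _ _ _ _ _ X mX P setT f.
  have := @ge0_integral_pushforward _ _ _ _ _ Y mY P setT f.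
  rewrite !preimage_setT => <- // <- //.
  apply: eq_measure_integral => A mA _; exact: XY.
have mg' : measurable_fun setT (EFin \o g) by exact/measurable_EFinP.
have intE (Z : T -> U) : (\int[P]_t (((g \o Z) t)%:E) =
    \int[P]_t ((EFin \o g)^\+%E \o Z) t - \int[P]_t ((EFin \o g)^\-%E \o Z) t)%E.
  by rewrite integralE -(funepos_comp (EFin \o g) Z) -(funeneg_comp (EFin \o g) Z).
rewrite unlock (intE X) (intE Y).
by congr (_ - _)%E; apply: main => //; [exact: measurable_funepos
                                      |exact: measurable_funeneg].
Qed.

End same_law.

(** * Joint law of two independent variables *)

Section independent_pair.
Context (R : realType) d (T : measurableType d) (P : probability T R).
Context d1 d2 (U : measurableType d1) (V : measurableType d2).

(** Both joint laws agree with the product of the laws of [X] and [Y] on measurable rectangles, and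
    a product measure is determined by its values there. *)
Lemma same_law_pair (X : T -> U) (Y Z : T -> V) :
  measurable_fun setT X -> measurable_fun setT Y -> measurable_fun setT Z ->
  (forall A B, measurable A -> measurable B ->
    P (X @^-1` A `&` Y @^-1` B) = (P (X @^-1` A) * P (Y @^-1` B))%E) ->
  (forall A B, measurable A -> measurable B ->
    P (X @^-1` A `&` Z @^-1` B) = (P (X @^-1` A) * P (Z @^-1` B))%E) ->
  (forall B, measurable B -> P (Y @^-1` B) = P (Z @^-1` B)) ->
  forall C, measurable C ->
    P ((fun t => (X t, Y t)) @^-1` C) = P ((fun t => (X t, Z t)) @^-1` C).
Proof.
move=> mX mY mZ XY XZ YZ C mC.
pose HX := isMeasurableFun.Build _ _ _ _ X mX.
pose X' : {mfun T >-> U} := HB.pack X HX.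
pose HY := isMeasurableFun.Build _ _ _ _ Y mY.
pose Y' : {mfun T >-> V} := HB.pack Y HY.
have mXY : measurable_fun setT (fun t => (X t, Y t)) by exact/measurable_fun_pair.
have mXZ : measurable_fun setT (fun t => (X t, Z t)) by exact/measurable_fun_pair.
pose HXY := isMeasurableFun.Build _ _ _ _ _ mXY.
pose XY' : {mfun T >-> (U * V)%type} := HB.pack (fun t => (X t, Y t)) HXY.
pose HXZ := isMeasurableFun.Build _ _ _ _ _ mXZ.
pose XZ' : {mfun T >-> (U * V)%type} := HB.pack (fun t => (X t, Z t)) HXZ.
transitivity ((distribution P X' \x distribution P Y')%E C).
  by symmetry; apply: (product_measure_unique (m' := distribution P XY')).
apply: (product_measure_unique (m' := distribution P XZ')) => // A B mA mB.
rewrite [LHS](XZ A B mA mB); congr (_ * _)%E.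
by symmetry; exact: YZ.
Qed.

End independent_pair.

(** * Square integrability and fourth moments *)

Section square_integrable.
Context (R : realType) d (T : measurableType d) (P : probability T R).
Implicit Types X Y : T -> R.

Lemma Lfun_measurable (p : \bar R) X : X \in Lfun P p -> measurable_fun setT X.
Proof. by rewrite inE => /andP[/[!inE]/=]. Qed.

Lemma Lfun2P X : X \in Lfun P 2%:E <->
  measurable_fun setT X /\ (\int[P]_t (X t ^+ 2)%:E < +oo)%E.
Proof.
split=> [X2|[mX X2]].
  split; first exact: Lfun_measurable X2.
  have /integrableP[_] := Lfun2_integrable_sqr X2.
  by under eq_integral do rewrite /= ger0_norm ?sqr_ge0//.
rewrite inE; apply/andP; split; rewrite inE//= /finite_norm unlock.
rewrite poweR_lty//.
under eq_integral => t _ do rewrite /= powR_mulrn// real_normK ?num_real//.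
by [].
Qed.

Lemma Lfun2_Lfun1 X : X \in Lfun P 2%:E -> X \in Lfun P 1.
Proof. by apply: Lfun_subset12; exact: fin_num_measure. Qed.

(** Stated as square integrability of [X ^ 2], so that products such as [X ^ 2 * Y] are integrable
    by Cauchy-Schwarz. *)
Definition fin_moment4 X :=
  measurable_fun setT X /\ (fun t => X t ^+ 2) \in Lfun P 2%:E.

Lemma fin_moment4_Lfun2 X : fin_moment4 X -> X \in Lfun P 2%:E.
Proof.
move=> [mX /Lfun2_Lfun1 /Lfun1_integrable /integrableP[_ X2]].
apply/Lfun2P; split => //; apply: le_lt_trans X2.
by under [leRHS]eq_integral do rewrite /= ger0_norm ?sqr_ge0//.
Qed.

Lemma gaussian_fin_moment4 X :
  measurable_fun setT X -> gaussian P X -> fin_moment4 X.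
Proof.
move=> mX gX; split => //; apply/Lfun2P.
split; first exact: measurable_funX.
under eq_integral => t _ do rewrite -exprM.
have m4 : measurable_fun [set: R] (fun x : R => (x ^+ 4)%:E).
  by apply/measurable_EFinP; exact: measurable_funX.
case: gX => [[m Xm]|[m [s [s0 Xms]]]].
  rewrite (_ : integral _ _ _ = \int[P]_t (m ^+ 4)%:E)%E.
    by rewrite integral_cst//= probability_setT mule1 ltry.
  apply: ae_eq_integral => //; first exact: (measurableT_comp m4).
  have mXm : measurable (X @^-1` [set m]) by rewrite -[X in measurable X]setTI; exact: mX.
  exists (~` (X @^-1` [set m])); split; first exact: measurableC.
  - by have := probability_setC P mXm; rewrite Xm subee.
  - by apply: subsetC => t /= -> _.
pose X' : T -> measurableTypeR R := X.
have mX' : measurable_fun setT X' by exact: mX.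
rewrite (_ : integral _ _ _ = \int[pushforward P X']_x (x ^+ 4)%:E)%E; last first.
  by rewrite ge0_integral_pushforward// => x _; rewrite lee_fin exprn_even_ge0.
apply: le_lt_trans (normal_prob_moment4 m s0).
rewrite le_eqVlt; apply/orP; left; apply/eqP.
apply: eq_measure_integral => A mA _; exact: (Xms A mA).
Qed.

End square_integrable.

(** * Real-valued expectation *)

Section mean.
Context (R : realType) d (T : measurableType d) (P : probability T R).
Implicit Types X Y : T -> R.

Definition mean X : R := fine 'E_P[X].

Lemma mean_sum (I : finType) (F : I -> T -> R) :
  (forall i, F i \in Lfun P 1) ->
  mean (fun t => \sum_i F i t) = \sum_i mean (F i).
Proof.
move=> F1.
have sumE (r : seq I) : (fun t => \sum_(i <- r) F i t) = \sum_(i <- r) F i.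
  by apply/funext => t; rewrite fct_sumE.
rewrite sumE; elim: (index_enum I) => [|i r IH].
  by rewrite !big_nil /mean expectation_cst.
rewrite !big_cons /mean expectationD ?rpred_sum// fineD ?expectation_fin_num ?rpred_sum//.
by congr (_ + _).
Qed.

Lemma meanD X Y : X \in Lfun P 1 -> Y \in Lfun P 1 ->
  mean (fun t => X t + Y t) = mean X + mean Y.
Proof.
by move=> X1 Y1; rewrite /mean expectationD// fineD ?expectation_fin_num.
Qed.

Lemma meanZ k X : X \in Lfun P 1 -> mean (fun t => k * X t) = k * mean X.
Proof.
move=> X1; rewrite /mean.
rewrite (_ : (fun t => k * X t) = k \o* X); last first.
  by apply/funext => t; rewrite /= mulrC.
by rewrite expectationZl// fineM ?expectation_fin_num.
Qed.

Lemma Lfun1Z k X : X \in Lfun P 1 -> (fun t => k * X t) \in Lfun P 1.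
Proof.
move=> X1; rewrite (_ : (fun t => k * X t) = k \o* X).
  exact: Lfun_scale.
by apply/funext => t; rewrite /= mulrC.
Qed.

(** This is how symmetry of a law kills odd moments: the mean equals its own opposite. *)
Lemma mean_opp_eq0 X Y : 'E_P[X]%E = 'E_P[Y]%E ->
  (forall t, Y t = - X t) -> X \in Lfun P 1 -> mean X = 0.
Proof.
move=> XY YN X1; have : mean X = - mean X.
  rewrite {1}/mean XY -/(mean _) -mulN1r -meanZ//; congr mean.
  by apply/funext => t; rewrite YN mulN1r.
by move/eqP; rewrite -addr_eq0 -mulr2n mulrn_eq0 => /eqP.
Qed.

End mean.

(** * Moments of the noise *)

Section affine_quadratic_moments.
Context (R : realType) d (T : measurableType d) (P : probability T R).
Context (I : finType) (x : I -> T -> R) (c alpha beta : R).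
Hypothesis x4 : forall i, fin_moment4 P (x i).
Hypothesis x1 : forall i, mean P (x i) = 0.
Hypothesis x2 : forall i j, mean P (fun t => x i t * x j t) = c * (i == j)%:R.
Hypothesis x3 : forall i j, mean P (fun t => x i t ^+ 2 * x j t) = 0.

(** Every directional score has the form [v * q + l D]: [q] carries the derivative in the variance,
    [l D] the derivative in the mean. *)
Let q t := beta + alpha * \sum_i x i t ^+ 2.
Let l (D : I -> R) t := \sum_i D i * x i t.

Lemma le1_2e : (1 <= 2%:E :> \bar R)%E.
Proof. by rewrite lee_fin ler1n. Qed.

Lemma Lfun_sumfun (J : finType) (p : \bar R) (p1 : (1 <= p)%E) (F : J -> T -> R) :
  (forall j, F j \in Lfun P p) -> (fun t => \sum_j F j t) \in Lfun P p.
Proof.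
move=> FL; rewrite (_ : (fun t => _) = \sum_j F j); last first.
  by apply/funext => t; rewrite fct_sumE.
have := @Lfun_submod_closed _ _ _ P p p1.
case=> L0 LD; elim/big_ind: _ => // f g fL gL.
by have := LD 1 f g fL gL; rewrite scale1r.
Qed.

Lemma Lfun2Z k (X : T -> R) : X \in Lfun P 2%:E ->
  (fun t => k * X t) \in Lfun P 2%:E.
Proof.
move=> X2; rewrite (_ : (fun t => k * X t) = k \o* X).
  by apply: Lfun_scale; rewrite ?ler1n.
by apply/funext => t; rewrite /= mulrC.
Qed.

Lemma Lfun2D (X Y : T -> R) : X \in Lfun P 2%:E -> Y \in Lfun P 2%:E ->
  (fun t => X t + Y t) \in Lfun P 2%:E.
Proof.
have := @Lfun_submod_closed _ _ _ P 2%:E le1_2e.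
by case=> _ LD X2 Y2; have := LD 1 X Y X2 Y2; rewrite scale1r.
Qed.

Lemma Lfun2_quadratic : q \in Lfun P 2%:E.
Proof.
apply: Lfun2D; first exact: Lfun_cst.
apply: Lfun2Z; apply: Lfun_sumfun => [|i]; first exact: le1_2e.
by case: (x4 i).
Qed.

Lemma Lfun2_linear D : l D \in Lfun P 2%:E.
Proof.
apply: Lfun_sumfun => [|i]; first exact: le1_2e.
by apply: Lfun2Z; exact: fin_moment4_Lfun2.
Qed.

(** After expansion only first moments and moments of type [x i ^ 2 * x j] occur, and all of them
    vanish. *)
Lemma mean_quadratic_linear D : mean P (fun t => q t * l D t) = 0.
Proof.
have xL i : x i \in Lfun P 2%:E by exact: fin_moment4_Lfun2.
have L i j : (fun t => x i t ^+ 2 * x j t) \in Lfun P 1.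
  by apply: Lfun2_mul_Lfun1 => //; case: (x4 i).
have qx j : (fun t => q t * x j t) \in Lfun P 1.
  by apply: Lfun2_mul_Lfun1 => //; exact: Lfun2_quadratic.
rewrite (_ : (fun t => _) = fun t => \sum_j D j * (q t * x j t)); last first.
  by apply/funext => t; rewrite mulr_sumr; apply: eq_bigr => j _; rewrite mulrCA.
rewrite mean_sum => [|j]; last exact: Lfun1Z.
apply: big1 => j _; rewrite meanZ//.
rewrite (_ : (fun t => _) =
  fun t => beta * x j t + alpha * \sum_i x i t ^+ 2 * x j t); last first.
  by apply/funext => t; rewrite /q mulrDl -mulrA mulr_suml.
have sL : (fun t => \sum_i x i t ^+ 2 * x j t) \in Lfun P 1.
  exact: Lfun_sumfun.
have xL1 : x j \in Lfun P 1 by exact: Lfun2_Lfun1.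
rewrite meanD ?Lfun1Z// !meanZ// x1 mean_sum//.
by rewrite big1// !mulr0 addr0 mulr0.
Qed.

Lemma mean_linear_linear D D' :
  mean P (fun t => l D t * l D' t) = c * \sum_i D i * D' i.
Proof.
have xL i : x i \in Lfun P 2%:E by exact: fin_moment4_Lfun2.
have L i j : (fun t => x i t * x j t) \in Lfun P 1 by exact: Lfun2_mul_Lfun1.
have L' i : (fun t => \sum_j D' j * (x i t * x j t)) \in Lfun P 1.
  by apply: Lfun_sumfun => // j; exact: Lfun1Z.
rewrite (_ : (fun t => _) =
  fun t => \sum_i D i * \sum_j D' j * (x i t * x j t)); last first.
  apply/funext => t; rewrite mulr_suml; apply: eq_bigr => i _.
  rewrite -mulrA; congr (_ * _); rewrite mulr_sumr.
  by apply: eq_bigr => j _; rewrite mulrCA.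
rewrite mean_sum => [|i]; last exact: Lfun1Z.
rewrite mulr_sumr; apply: eq_bigr => i _; rewrite meanZ// mulrCA.
congr (_ * _); rewrite mean_sum => [|j]; last exact: Lfun1Z.
rewrite (bigD1 i)//= meanZ// x2 eqxx mulr1 mulrC big1 ?addr0// => j ji.
by rewrite meanZ// x2 eq_sym (negbTE ji) !mulr0.
Qed.

(** The cross terms are zero, so the variance direction decouples from the mean directions. *)
Lemma mean_affine_quadratic (v v' : R) (D D' : I -> R) :
  mean P (fun t => (v * q t + l D t) * (v' * q t + l D' t)) =
  v * v' * mean P (fun t => q t ^+ 2) + c * \sum_i D i * D' i.
Proof.
have qL := Lfun2_quadratic; have lL := Lfun2_linear.
have qq : (fun t => q t ^+ 2) \in Lfun P 1 by exact: (Lfun2_mul_Lfun1 qL qL).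
have ql E : (fun t => q t * l E t) \in Lfun P 1 by exact: Lfun2_mul_Lfun1.
have ll : (fun t => l D t * l D' t) \in Lfun P 1 by exact: Lfun2_mul_Lfun1.
have add X Y : X \in Lfun P 1 -> Y \in Lfun P 1 ->
  (fun t => X t + Y t) \in Lfun P 1 by move=> X1 Y1; exact: rpredD.
rewrite (_ : (fun t => _) = fun t => v * v' * q t ^+ 2 +
    (v * (q t * l D' t) + (v' * (q t * l D t) + l D t * l D' t))); last first.
  by apply/funext => t; ring.
rewrite meanD ?meanD ?Lfun1Z ?add ?Lfun1Z// ?add ?Lfun1Z//.
by rewrite !meanZ// !mean_quadratic_linear mean_linear_linear !mulr0 !add0r.
Qed.

(* A vanishing second moment would make every [x i] almost surely bounded. *)
Lemma mean_quadratic_sqr_neq0 i (m s : R) : 0 < alpha -> 0 < s ->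
  (forall A : set R, measurable A -> P (x i @^-1` A) = normal_prob m s A) ->
  mean P (fun t => q t ^+ 2) != 0.
Proof.
move=> a0 s0 xi; apply/eqP => q0.
have qL := Lfun2_quadratic.
have qq : (fun t => q t ^+ 2) \in Lfun P 1 by exact: (Lfun2_mul_Lfun1 qL qL).
have q2 : (\int[P]_t `|(q t ^+ 2)%:E| = 0)%E.
  have := expectation_fin_num qq; move: q0; rewrite /mean unlock => q0 qfin.
  rewrite -[RHS](_ : (\int[P]_t (q t ^+ 2)%:E = 0)%E).
    by apply: eq_integral => t _; rewrite /= ger0_norm// sqr_ge0.
  by rewrite -(fineK qfin) q0.
have : ae_eq P setT (fun t => (q t ^+ 2)%:E) (cst 0%E).
  apply/ae_eq_integral_abs => //.
  by apply/measurable_EFinP; exact: Lfun_measurable qq.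
move=> [B [mB B0 sub]].
(* Where [q] vanishes the energy equals [- beta / alpha]. A coordinate that is at least [C >= 1]
   makes the energy at least [C ^ 2 >= C], which exceeds that value. *)
pose C := `|beta / alpha| + 1.
have mC : measurable [set y : R | C <= y].
  have -> : [set y : R | C <= y] = `[C, +oo[%classic.
    by apply/seteqP; split=> y /=; rewrite in_itv/= andbT.
  exact: measurable_itv.
have C1 : 1 <= C by rewrite lerDr.
have : (P (x i @^-1` [set y : R | (C <= y)%R]) <= P B)%E.
  apply: le_measure; rewrite ?inE//.
    by rewrite -[X in measurable X]setTI; apply: (x4 i).1.
  apply: (subset_trans _ sub) => t /= Cx /(_ Logic.I).
  move=> /eqP; rewrite eqe sqrf_eq0 => /eqP.
  move/eqP; rewrite /q addrC addr_eq0 => /eqP /(congr1 (fun u => u / alpha)).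
  rewrite mulrAC mulfV ?gt_eqF// mul1r mulNr => sq.
  have CC : C ^+ 2 <= x i t ^+ 2.
    by rewrite ler_sqr ?nnegrE// (le_trans ler01)// (le_trans C1).
  have xs : x i t ^+ 2 <= \sum_j x j t ^+ 2.
    by rewrite (bigD1 i)//= lerDl sumr_ge0// => j _; rewrite sqr_ge0.
  have bC : - (beta / alpha) <= C - 1 by rewrite addrK -normrN ler_norm.
  have CC1 : C <= C ^+ 2 by rewrite expr2 ler_peMl// (le_trans ler01).
  rewrite sq in xs; lra.
rewrite B0 xi// leNgt => /negP; apply.
exact: normal_prob_tail_gt0.
Qed.

End affine_quadratic_moments.

(** * Real coordinates of complex vectors *)

Section reim.
Context (R : realType) (n : nat).
Implicit Types u z : 'cV[R[i]]_n.

Lemma reim_lshift z i : tnth (reim z) (lshift n i) = complex.Re (z i 0).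
Proof. by rewrite tnth_lshift tnth_mktuple. Qed.

Lemma reim_rshift z i : tnth (reim z) (rshift n i) = complex.Im (z i 0).
Proof. by rewrite tnth_rshift tnth_mktuple. Qed.

Lemma ReD (a b : R[i]) : complex.Re (a + b) = complex.Re a + complex.Re b.
Proof. by case: a b => ? ? [? ?]. Qed.

Lemma ImD (a b : R[i]) : complex.Im (a + b) = complex.Im a + complex.Im b.
Proof. by case: a b => ? ? [? ?]. Qed.

Lemma Re_sum (I : finType) (F : I -> R[i]) :
  complex.Re (\sum_i F i) = \sum_i complex.Re (F i).
Proof. exact: (big_morph _ ReD). Qed.

Lemma Im_sum (I : finType) (F : I -> R[i]) :
  complex.Im (\sum_i F i) = \sum_i complex.Im (F i).
Proof. exact: (big_morph _ ImD). Qed.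

(** The real part of the Hermitian product is the Euclidean product of the real coordinates; all
    later moment computations pass through this identity. *)
Lemma Re_trmxC_mul u z :
  complex.Re (((u ^t*) *m z) 0 0) = \sum_a tnth (reim u) a * tnth (reim z) a.
Proof.
rewrite mxE Re_sum big_split_ord/= -big_split/=; apply: eq_bigr => i _.
rewrite !reim_lshift !reim_rshift !mxE.
by case: (u i 0) (z i 0) => a b [c e] /=; rewrite mulNr opprK.
Qed.

Lemma reim_oppr z a : tnth (reim (- z)) a = - tnth (reim z) a.
Proof.
by rewrite -[a]splitK; case: (fintype.split a) => i /=;
  rewrite ?reim_lshift ?reim_rshift mxE; case: (z i 0).
Qed.

Lemma expi_pi : expi (pi : R) = -1.
Proof. by rewrite /expi cospi sinpi; apply/eqP; rewrite eq_complex/= oppr0 !eqxx. Qed.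

Lemma expi_pihalf : expi (pi / 2 : R) = 'i.
Proof. by rewrite /expi cos_pihalf sin_pihalf. Qed.

Definition of_reim (v : 'I_(n + n) -> R) : 'cV[R[i]]_n :=
  \col_i (v (lshift n i) +i* v (rshift n i)).

Lemma of_reimK v a : tnth (reim (of_reim v)) a = v a.
Proof.
by rewrite -[a]splitK; case: (fintype.split a) => i /=;
  rewrite ?reim_lshift ?reim_rshift mxE.
Qed.

End reim.

(** * Moments of a single noise vector *)

Section noise_vector.
Context (R : realType) d (T : measurableType d) (P : probability T R) (n : nat).
Context (Z : T -> 'cV[R[i]]_n) (s2 : R).
Hypothesis gZ : complex_gaussian P Z.
Hypothesis mZ : zero_mean P Z.
Hypothesis cZ : circularly_symmetric P Z.
Hypothesis covZ : covariance_mx P Z = (s2%:C)%:M.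
Let x a t := tnth (reim (Z t)) a.

Lemma component_measurable a : measurable_fun setT (x a).
Proof. exact: (measurableT_comp (@measurable_tnth _ _ _ a) gZ.1). Qed.

(** The vector [u] in the definition of [complex_gaussian] is taken to be the one whose real
    coordinates form the [a]-th unit vector. *)
Lemma component_gaussian a : gaussian P (x a).
Proof.
have := gZ.2 (of_reim (fun b => (b == a)%:R)).
congr gaussian; apply/funext => t; rewrite Re_trmxC_mul (bigD1 a)//=.
by rewrite of_reimK eqxx mul1r big1 ?addr0// => b ba; rewrite of_reimK (negbTE ba) mul0r.
Qed.

Lemma component_fin_moment4 a : fin_moment4 P (x a).
Proof. exact: gaussian_fin_moment4 (component_measurable a) (component_gaussian a). Qed.

Lemma component_Lfun2 a : x a \in Lfun P 2%:E.
Proof. exact: fin_moment4_Lfun2 (component_fin_moment4 a). Qed.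

Lemma component_mean a : mean P (x a) = 0.
Proof.
rewrite -[a]splitK; case: (fintype.split a) => i /=.
- have /(congr1 (@complex.Re R)) /= <- := mZ i.
  by congr mean; apply/funext => t; exact: reim_lshift.
- have /(congr1 (@complex.Im R)) /= <- := mZ i.
  by congr mean; apply/funext => t; exact: reim_rshift.
Qed.

Lemma measurable_reim (Y : T -> 'cV[R[i]]_n) :
  (forall a, measurable_fun setT (fun t => tnth (reim (Y t)) a)) ->
  measurable_fun setT (fun t => reim (Y t)).
Proof. by move=> mY; apply/measurable_fun_tnthP => a; exact: mY. Qed.

Lemma measurable_reim_opp : measurable_fun setT (fun t => reim (- Z t)).
Proof.
apply: measurable_reim => a.
rewrite (_ : (fun t => _) = \- x a).
  by apply: measurableT_comp => //; exact: component_measurable.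
by apply/funext => t; rewrite reim_oppr.
Qed.

(** Negation is the rotation by the angle pi. *)
Lemma reim_opp_same_law A : measurable A ->
  P ((fun t => reim (Z t)) @^-1` A) = P ((fun t => reim (- Z t)) @^-1` A).
Proof.
move=> mA; rewrite -[LHS](cZ pi mA) expi_pi; congr (P _).
by apply/funext => t; rewrite /= scaleN1r.
Qed.

Lemma component_moment3 a b : mean P (fun t => x a t ^+ 2 * x b t) = 0.
Proof.
pose g (y : (n + n).-tuple R) := tnth y a ^+ 2 * tnth y b.
have mg : measurable_fun setT g.
  by apply: measurable_funM; [apply: measurable_funX|]; exact: measurable_tnth.
have E := expectation_same_law gZ.1 measurable_reim_opp mg reim_opp_same_law.
apply: (mean_opp_eq0 E) => [t|].
  by rewrite /g /= !reim_oppr sqrrN mulrN.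
apply: Lfun2_mul_Lfun1; [exact: (component_fin_moment4 a).2|exact: component_Lfun2].
Qed.

Lemma reim_mulI_lshift z i : tnth (reim ('i *: z)) (lshift n i) = - tnth (reim z) (rshift n i) :> R.
Proof.
rewrite reim_lshift reim_rshift mxE; case: (z i 0) => a b /=.
by rewrite mul0r mul1r sub0r.
Qed.

Lemma reim_mulI_rshift z i : tnth (reim ('i *: z)) (rshift n i) = tnth (reim z) (lshift n i) :> R.
Proof.
rewrite reim_lshift reim_rshift mxE; case: (z i 0) => a b /=.
by rewrite mul0r mul1r add0r.
Qed.

(** Rotation by pi / 2 is multiplication by the imaginary unit, which exchanges real and imaginary
    parts up to a sign. *)
Lemma mean_mulI a b : mean P (fun t => x a t * x b t) =
  mean P (fun t => tnth (reim ('i *: Z t)) a * tnth (reim ('i *: Z t)) b).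
Proof.
pose g (y : (n + n).-tuple R) := tnth y a * tnth y b.
have mg : measurable_fun setT g.
  by apply: measurable_funM; exact: measurable_tnth.
have mI : measurable_fun setT (fun t => reim ('i *: Z t)).
  apply: measurable_reim => e; rewrite -[e]splitK; case: (fintype.split e) => i /=.
  - under eq_fun do rewrite reim_mulI_lshift.
    by apply: measurableT_comp => //; exact: component_measurable.
  - under eq_fun do rewrite reim_mulI_rshift.
    exact: component_measurable.
congr fine; apply: (expectation_same_law gZ.1 mI mg) => A mA.
by rewrite -[LHS](cZ (pi / 2) mA) expi_pihalf.
Qed.

(** Write [z = x + i y]. The quarter turn gives [E(y y') = E(x x')] and [E(x y') = - E(y x')]. The
    covariance fixes [E(x x') + E(y y')] through its real part and [E(y x') - E(x y')] through its
    imaginary part, which determines all four moments. *)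
Lemma component_moment2 a b :
  mean P (fun t => x a t * x b t) = s2 / 2 * (a == b)%:R.
Proof.
have L a' b' : (fun t => x a' t * x b' t) \in Lfun P 1.
  by apply: Lfun2_mul_Lfun1; exact: component_Lfun2.
have rr i j : mean P (fun t => x (rshift n i) t * x (rshift n j) t) =
              mean P (fun t => x (lshift n i) t * x (lshift n j) t).
  rewrite mean_mulI; congr mean; apply/funext => t.
  by rewrite !reim_mulI_rshift.
have lr i j : mean P (fun t => x (lshift n i) t * x (rshift n j) t) =
            - mean P (fun t => x (rshift n i) t * x (lshift n j) t).
  rewrite mean_mulI -mulN1r -meanZ//; congr mean; apply/funext => t.
  by rewrite reim_mulI_lshift reim_mulI_rshift mulN1r mulNr.
have cov i j : mean P (fun t => x (lshift n i) t * x (lshift n j) t) +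
               mean P (fun t => x (rshift n i) t * x (rshift n j) t) =
               s2 * (i == j)%:R
            /\ mean P (fun t => x (rshift n i) t * x (lshift n j) t) -
               mean P (fun t => x (lshift n i) t * x (rshift n j) t) = 0.
  have /matrixP/(_ i j) := covZ; rewrite !mxE.
  have e t : (Z t *m ((Z t) ^t*)) i j = (x (lshift n i) t * x (lshift n j) t +
      x (rshift n i) t * x (rshift n j) t) +i*
      (x (rshift n i) t * x (lshift n j) t +
       -1 * (x (lshift n i) t * x (rshift n j) t)).
    rewrite mxE big_ord1 /x !reim_lshift !reim_rshift !mxE.
    case: (Z t i 0) (Z t j 0) => a1 a2 [b1 b2] /=.
    by apply/eqP; rewrite eq_complex /=; apply/andP; split; apply/eqP; ring.
  rewrite /cexpectation => /eqP; rewrite eq_complex => /andP[/eqP re /eqP im].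
  split.
  - move: re => /=; under eq_fun do rewrite e /=.
    rewrite -/(mean _ _) meanD// => ->.
    by case: eqP; rewrite ?mulr1n ?mulr0n ?mulr1 ?mulr0.
  - move: im => /=; under eq_fun do rewrite e /=.
    rewrite -/(mean _ _) meanD ?Lfun1Z// meanZ// mulN1r => ->.
    by case: eqP; rewrite ?mulr1n ?mulr0n.
have ll i j : mean P (fun t => x (lshift n i) t * x (lshift n j) t) =
    s2 / 2 * (i == j)%:R.
  have [] := cov i j; rewrite rr => h _; lra.
have lr0 i j : mean P (fun t => x (lshift n i) t * x (rshift n j) t) = 0.
  have [_] := cov i j; have := lr i j; lra.
have rl0 i j : mean P (fun t => x (rshift n i) t * x (lshift n j) t) = 0.
  have := lr i j; rewrite lr0; lra.
rewrite -[a]splitK -[b]splitK.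
case: (fintype.split a) => i; case: (fintype.split b) => j /=.
- by rewrite ll eq_lshift.
- by rewrite lr0 eq_lrshift mulr0.
- by rewrite rl0 eq_rlshift mulr0.
- by rewrite rr ll eq_rshift.
Qed.

(** The predicate [gaussian] admits constants. A constant coordinate would equal its mean 0, against
    the second moment [s2 / 2 > 0]. *)
Lemma component_normal a : 0 < s2 ->
  exists m s : R, 0 < s /\
    forall A : set R, measurable A -> P (x a @^-1` A) = normal_prob m s A.
Proof.
move=> s0; case: (component_gaussian a) => [[m xm]|//].
have mxm : measurable (x a @^-1` [set m]).
  by rewrite -[X in measurable X]setTI; apply: component_measurable.
have ae (f g : T -> R) : measurable_fun setT f -> measurable_fun setT g ->
    (forall t, x a t = m -> f t = g t) -> mean P f = mean P g.
  move=> mf mg fg; rewrite /mean unlock; congr fine.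
  apply: ae_eq_integral => //; [exact/measurable_EFinP|exact/measurable_EFinP|].
  exists (~` (x a @^-1` [set m])); split; first exact: measurableC.
  - by have := probability_setC P mxm; rewrite xm subee.
  - by apply: subsetC => t /= /fg -> _.
have m0 : m = 0.
  rewrite -(component_mean a) (ae _ (cst m))//; last exact: component_measurable.
  by rewrite /mean expectation_cst.
have /eqP := component_moment2 a a.
rewrite eqxx mulr1 (ae _ (cst 0)); last 3 first.
- by apply: measurable_funM; exact: component_measurable.
- exact: measurable_cst.
- by move=> t ->; rewrite m0 mulr0.
rewrite /mean expectation_cst /= eq_sym mulf_eq0 invr_eq0 pnatr_eq0 orbF.
by rewrite gt_eqF.
Qed.

End noise_vector.

(** * Joint moments of the independent noise vectors *)

Section noise_family.
Context (R : realType) d (T : measurableType d) (P : probability T R) (n N : nat).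
Context (w : 'I_N -> T -> 'cV[R[i]]_n) (s2 : R).
Hypothesis gw : forall f, complex_gaussian P (w f).
Hypothesis mw : forall f, zero_mean P (w f).
Hypothesis cw : forall f, circularly_symmetric P (w f).
Hypothesis covw : forall f, covariance_mx P (w f) = (s2%:C)%:M.
Hypothesis iw : independent_cvecs P w.

Lemma independent_cvecs_pair f g (A B : set ((n + n).-tuple R)) :
  f != g -> measurable A -> measurable B ->
  P ((fun t => reim (w f t)) @^-1` A `&` (fun t => reim (w g t)) @^-1` B) =
  (P ((fun t => reim (w f t)) @^-1` A) * P ((fun t => reim (w g t)) @^-1` B))%E.
Proof.
move=> fg mA mB.
(* The whole space at every index other than [f] and [g] leaves just two factors of the product rule
   different from 1. *)
pose C h := if h == f then A else if h == g then B else setT.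
have mC h : measurable (C h) by rewrite /C; case: ifP => // _; case: ifP.
have Cf : C f = A by rewrite /C eqxx.
have Cg : C g = B by rewrite /C eq_sym (negbTE fg) eqxx.
have := iw mC; rewrite (bigD1 f)//= (bigD1 g)/=; last by rewrite eq_sym.
rewrite Cf Cg big1 => [|h /andP[hf hg]]; last first.
  by rewrite /C (negbTE hf) (negbTE hg) (_ : [set _ | _] = setT) ?probability_setT.
rewrite mule1 => <-; congr (P _); apply/seteqP; split=> t /=.
  move=> [tA tB] h; rewrite /C; case: eqP => [->//|_]; by case: eqP => [->//|].
by move=> h; split; [have := h f; rewrite Cf|have := h g; rewrite Cg].
Qed.

Let opp_tuple (y : (n + n).-tuple R) := mktuple (fun i => - tnth y i).

Lemma measurable_opp_tuple : measurable_fun setT opp_tuple.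
Proof.
apply/measurable_fun_tnthP => a.
rewrite (_ : _ \o _ = fun y => - tnth y a); last first.
  by apply/funext => y; rewrite /= tnth_mktuple.
by apply: measurableT_comp => //; exact: measurable_tnth.
Qed.

Lemma reim_oppE (z : 'cV[R[i]]_n) : reim (- z) = opp_tuple (reim z).
Proof. by apply: eq_from_tnth => a; rewrite reim_oppr tnth_mktuple. Qed.

(* Independence and symmetry: (w f, w g) and (w f, - w g) have the same law. *)
Lemma mean_independent_odd f g (h : (n + n).-tuple R -> R) b :
  f != g -> measurable_fun setT h -> (fun t => h (reim (w f t))) \in Lfun P 2%:E ->
  mean P (fun t => h (reim (w f t)) * tnth (reim (w g t)) b) = 0.
Proof.
move=> fg mh hL.
pose G (uv : (n + n).-tuple R * (n + n).-tuple R) := h uv.1 * tnth uv.2 b.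
have mG : measurable_fun setT G.
  apply: measurable_funM; first exact: (measurableT_comp mh measurable_fst).
  exact: (measurableT_comp (@measurable_tnth _ _ _ b) measurable_snd).
have mf := (gw f).1; have mg := (gw g).1.
have mNg := measurable_reim_opp (gw g).
have mX : measurable_fun setT (fun t => (reim (w f t), reim (w g t))).
  exact/measurable_fun_pair.
have mY : measurable_fun setT (fun t => (reim (w f t), reim (- w g t))).
  exact/measurable_fun_pair.
have law : forall C, measurable C ->
    P ((fun t => (reim (w f t), reim (w g t))) @^-1` C) =
    P ((fun t => (reim (w f t), reim (- w g t))) @^-1` C).
  apply: same_law_pair => // [A B mA mB|A B mA mB|B mB].
  - exact: independent_cvecs_pair.
  - pose B' := opp_tuple @^-1` B.
    have mB' : measurable B'.
      by rewrite -[B']setTI; exact: measurable_opp_tuple.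
    have e : (fun t => reim (- w g t)) @^-1` B = (fun t => reim (w g t)) @^-1` B'.
      by rewrite /B'; apply/seteqP; split=> t /=; rewrite reim_oppE.
    by rewrite e; exact: independent_cvecs_pair.
  - exact: (reim_opp_same_law (cw g) mB).
have E := expectation_same_law mX mY mG law.
apply: (mean_opp_eq0 E) => [t|]; first by rewrite /G /= reim_oppr mulrN.
by apply: Lfun2_mul_Lfun1 => //; exact: component_Lfun2 (gw g) b.
Qed.

Let x (fa : 'I_N * 'I_(n + n)) t := tnth (reim (w fa.1 t)) fa.2.

Lemma noise_moment2 fa gb :
  mean P (fun t => x fa t * x gb t) = s2 / 2 * (fa == gb)%:R.
Proof.
case: fa gb => [f a] [g b]; rewrite /x xpair_eqE /=.
have [<-|fg] /= := eqVneq f g; first exact: component_moment2 (gw f) (cw f) (covw f) a b.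
rewrite mulr0.
apply: (mean_independent_odd (h := fun y => tnth y a) b fg).
  exact: measurable_tnth.
exact: component_Lfun2 (gw f) a.
Qed.

Lemma noise_moment3 fa gb : mean P (fun t => x fa t ^+ 2 * x gb t) = 0.
Proof.
case: fa gb => [f a] [g b]; rewrite /x /=.
have [<-|fg] := eqVneq f g; first exact: component_moment3 (gw f) (cw f) a b.
apply: (mean_independent_odd (h := fun y => tnth y a ^+ 2) b fg).
  by apply: measurable_funX; exact: measurable_tnth.
exact: (component_fin_moment4 (gw f) a).2.
Qed.

(** The pairs (snapshot, real coordinate) form a single finite index set of uncorrelated variables
    of variance [s2 / 2], to which [mean_affine_quadratic] applies. *)
Lemma mean_score_product (alpha beta v v' : R) (D D' : 'I_N -> 'cV[R[i]]_n) :
  let q t := beta + alpha * \sum_f complex.Re (((w f t ^t*) *m w f t) 0 0) in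
  let l (D : 'I_N -> 'cV[R[i]]_n) t :=
    \sum_f complex.Re ((D f ^t* *m w f t) 0 0) in
  mean P (fun t => (v * q t + l D t) * (v' * q t + l D' t)) =
  v * v' * mean P (fun t => q t ^+ 2)
  + s2 / 2 * \sum_f complex.Re ((D f ^t* *m D' f) 0 0).
Proof.
move=> q l.
have qE t : q t = beta + alpha * \sum_fa x fa t ^+ 2.
  congr (_ + _ * _); rewrite -(pair_bigA _ (fun f a => x (f, a) t ^+ 2))/=.
  by apply: eq_bigr => f _; rewrite Re_trmxC_mul; apply: eq_bigr => a _; rewrite expr2.
pose c (D : 'I_N -> 'cV[R[i]]_n) fa := tnth (reim (D fa.1)) fa.2.
have lE E t : l E t = \sum_fa c E fa * x fa t.
  rewrite -(pair_bigA _ (fun f a => c E (f, a) * x (f, a) t))/=.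
  by apply: eq_bigr => f _; rewrite Re_trmxC_mul.
have -> : \sum_f complex.Re ((D f ^t* *m D' f) 0 0) = \sum_fa c D fa * c D' fa.
  rewrite -(pair_bigA _ (fun f a => c D (f, a) * c D' (f, a)))/=.
  by apply: eq_bigr => f _; rewrite Re_trmxC_mul.
under eq_fun do rewrite qE !lE.
under [in RHS]eq_fun do rewrite qE.
apply: mean_affine_quadratic => [fa|fa|fa gb|fa gb].
- exact: component_fin_moment4 (gw fa.1) fa.2.
- exact: component_mean (mw fa.1) fa.2.
- exact: noise_moment2.
- exact: noise_moment3.
Qed.

(** One nondegenerate Gaussian coordinate is enough, and it exists because [n] and [N] are
    positive. *)
Lemma mean_noise_energy_neq0 (alpha beta : R) :
  (0 < n)%N -> (0 < N)%N -> 0 < s2 -> 0 < alpha ->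
  mean P (fun t => (beta + alpha *
    \sum_f complex.Re (((w f t ^t*) *m w f t) 0 0)) ^+ 2) != 0.
Proof.
move=> n0 N0 s20 a0; pose f0 := Ordinal N0.
pose b0 : 'I_(n + n) := lshift n (Ordinal n0).
have [m [s [s0 xms]]] := component_normal (gw f0) (mw f0) (cw f0) (covw f0) b0 s20.
have qE t : \sum_f complex.Re (((w f t ^t*) *m w f t) 0 0) = \sum_fa x fa t ^+ 2.
  rewrite -(pair_bigA _ (fun f a => x (f, a) t ^+ 2))/=.
  by apply: eq_bigr => f _; rewrite Re_trmxC_mul; apply: eq_bigr => a _; rewrite expr2.
under eq_fun do rewrite qE.
apply: (@mean_quadratic_sqr_neq0 _ _ _ P _ x alpha beta _ (f0, b0) m s) => //.
by move=> fa; exact: component_fin_moment4 (gw fa.1) fa.2.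
Qed.

End noise_family.

(** * The score *)

Section derive_line.
Context (R : realType).

(** The difference quotients coincide, so directional derivatives in the parameter space become
    ordinary derivatives at 0 along a line. *)
Lemma derive_line (V : normedModType R) (f : V -> R) (a v : V) (l : R) :
  is_derive (0 : R) 1 (fun r : R => f (r *: v + a)) l -> 'D_v f a = l.
Proof.
move=> [_ <-]; rewrite /derive.
apply: (congr1 (fun F : R -> R => lim (F @ 0^'))).
by apply/funext => r /=; rewrite addr0 scale0r add0r [_%:A]mulr1.
Qed.

(** Real and imaginary parts are differentiated separately, in agreement with [cpartial]. *)
Definition is_cderive (g : R -> R[i]) (l : R[i]) : Prop :=
  is_derive (0 : R) 1 (fun r => complex.Re (g r)) (complex.Re l) /\
  is_derive (0 : R) 1 (fun r => complex.Im (g r)) (complex.Im l).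

Lemma is_cderive_cst a : is_cderive (fun=> a) 0.
Proof. by split; exact: is_derive_cst. Qed.

Lemma is_cderiveM g h a b : is_cderive g a -> is_cderive h b ->
  is_cderive (fun r => g r * h r) (a * h 0 + g 0 * b).
Proof.
have ReM (x y : R[i]) : complex.Re (x * y) =
  complex.Re x * complex.Re y - complex.Im x * complex.Im y.
  by case: x y => ? ? [? ?].
have ImM (x y : R[i]) : complex.Im (x * y) =
  complex.Re x * complex.Im y + complex.Im x * complex.Re y.
  by case: x y => ? ? [? ?].
move=> [g1 g2] [h1 h2]; split.
- under eq_fun do rewrite ReM.
  have H := (is_deriveB (is_deriveM g1 h1) (is_deriveM g2 h2)).
  apply: (is_derive_eq H).
  by rewrite ReD !ReM /GRing.scale/=; ring.
- under eq_fun do rewrite ImM.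
  have H := (is_deriveD (is_deriveM g1 h2) (is_deriveM g2 h1)).
  apply: (is_derive_eq H).
  by rewrite ImD !ImM /GRing.scale/=; ring.
Qed.

Lemma is_cderive_sum (n : nat) (g : 'I_n -> R -> R[i]) (a : 'I_n -> R[i]) :
  (forall k, is_cderive (g k) (a k)) ->
  is_cderive (fun r => \sum_k g k r) (\sum_k a k).
Proof.
move=> ga; split.
- rewrite (_ : (fun r => _) = \sum_k (fun r => complex.Re (g k r))).
    by rewrite Re_sum; apply: is_derive_sum => k; case: (ga k).
  by apply/funext => r; rewrite Re_sum fct_sumE.
- rewrite (_ : (fun r => _) = \sum_k (fun r => complex.Im (g k r))).
    by rewrite Im_sum; apply: is_derive_sum => k; case: (ga k).
  by apply/funext => r; rewrite Im_sum fct_sumE.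
Qed.

Lemma is_derive_affine (a b : R) : is_derive (0 : R) 1 (fun r => r * a + b) a.
Proof.
have H := is_deriveD (is_deriveM (is_derive_id (0 : R) (1 : R))
  (is_derive_cst a (0 : R) (1 : R))) (is_derive_cst b (0 : R) (1 : R)).
apply: (is_derive_eq H).
by rewrite /GRing.scale/= mulr0 add0r mulr1 addr0.
Qed.

Lemma is_cderive_affine (a b : R[i]) : is_cderive (fun r => r%:C * a + b) a.
Proof.
split.
- rewrite (_ : (fun r => _) = fun r => r * complex.Re a + complex.Re b).
    exact: is_derive_affine.
  by apply/funext => r; rewrite ReD; case: a => ? ? /=; rewrite mul0r subr0.
- rewrite (_ : (fun r => _) = fun r => r * complex.Im a + complex.Im b).
    exact: is_derive_affine.
  by apply/funext => r; rewrite ImD; case: a => ? ? /=; rewrite mul0r addr0.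
Qed.

Lemma is_cderive_expi (a b : R) :
  is_cderive (fun r => expi (r * a + b)) ('i * a%:C * expi b).
Proof.
have aff := is_derive_affine a b.
have aff0 : 0 * a + b = b by rewrite mul0r add0r.
split.
- have c := is_derive_cos (0 * a + b).
  have H := @is_derive1_comp _ _ (fun r : R => r * a + b) 0 _ _ c aff.
  apply: (is_derive_eq H).
  by rewrite aff0 /= !(mul0r, mul1r, mulr0, subr0, sub0r, addr0, add0r); ring.
- have c := is_derive_sin (0 * a + b).
  have H := @is_derive1_comp _ _ (fun r : R => r * a + b) 0 _ _ c aff.
  apply: (is_derive_eq H).
  by rewrite aff0 /= !(mul0r, mul1r, mulr0, subr0, sub0r, addr0, add0r); ring.
Qed.

End derive_line.

(** * Derivatives of the mixing matrix and of the mean *)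

Section mixing_derivative.
Context (R : realType) (M K P : nat) (p : 'I_M -> R) (B : 'M[R[i]]_(P, K)).

Lemma mixing_mxE (phi : 'rV[R]_K) m k : mixing_mx p B phi m k =
  expi (phi 0 k * p (mxtens_unindex m).1) * B (mxtens_unindex m).2 k.
Proof. by rewrite !mxE. Qed.

(** Column [k] depends on [phi] only through an exponential in [phi 0 k], so differentiation
    multiplies the entry by a purely imaginary factor. *)
Lemma is_cderive_mixing (phi psi : 'rV[R]_K) m k :
  is_cderive (fun r => mixing_mx p B (r *: psi + phi) m k)
    ('i * (psi 0 k * p (mxtens_unindex m).1)%:C * mixing_mx p B phi m k).
Proof.
set pm := p _; rewrite mixing_mxE -/pm mulrA.
have H := is_cderiveM (is_cderive_expi (psi 0 k * pm) (phi 0 k * pm))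
  (is_cderive_cst (B (mxtens_unindex m).2 k)).
rewrite mulr0 addr0 in H.
rewrite (_ : (fun r => _) = fun r => expi (r * (psi 0 k * pm) + phi 0 k * pm)
  * B (mxtens_unindex m).2 k)//.
by apply/funext => r; rewrite mixing_mxE !mxE mulrDl mulrA.
Qed.

Lemma dmixing_mxE (phi : 'rV[R]_K) m k : dmixing_mx p B phi m k =
  'i * (p (mxtens_unindex m).1)%:C * mixing_mx p B phi m k.
Proof.
have [h1 h2] := is_cderive_mixing phi (delta_mx 0 k) m k.
rewrite mxE /cpartial.
rewrite (derive_line (f := fun t => complex.Re (mixing_mx p B t m k)) h1).
rewrite (derive_line (f := fun t => complex.Im (mixing_mx p B t m k)) h2).
rewrite mxE !eqxx mul1r; by case: (_ * _).
Qed.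

(* Derivative of [phi, S |-> mixing_mx p B phi *m S] at [(phi, S)] in the
   direction [(psi, s)]. *)
Definition mean_diff (phi psi : 'rV[R]_K) (S s : 'cV[R[i]]_K) :=
  mixing_mx p B phi *m s +
  dmixing_mx p B phi *m (diag_mx (map_mx (real_complex R) psi) *m S).

(** Product rule, entry by entry: since column [k] varies with [phi 0 k] alone, the direction [psi]
    enters as a diagonal matrix to the right of the matrix of derivatives. *)
Lemma is_cderive_mean (phi psi : 'rV[R]_K) (S s : 'cV[R[i]]_K) m :
  is_cderive (fun r => (mixing_mx p B (r *: psi + phi) *m (r%:C *: s + S)) m 0)
    (mean_diff phi psi S s m 0).
Proof.
under eq_fun do rewrite mxE.
rewrite /mean_diff !mxE -big_split/=.
apply: is_cderive_sum => k.
have H := is_cderiveM (is_cderive_mixing phi psi m k) (is_cderive_affine (s k 0) (S k 0)).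
rewrite (_ : _ + _ = 'i * (psi 0 k * p (mxtens_unindex m).1)%:C *
   mixing_mx p B phi m k * (0%:C * s k 0 + S k 0) +
   mixing_mx p B (0 *: psi + phi) m k * s k 0).
  rewrite (_ : (fun r => _) = fun r : R => mixing_mx p B (r *: psi + phi) m k *
    (r%:C * s k 0 + S k 0))//.
  by apply/funext => r; congr (_ * _); rewrite !mxE.
rewrite dmixing_mxE scale0r add0r rmorph0 mul0r add0r addrC.
set G := mixing_mx p B phi m k; rewrite mul_diag_mx !mxE.
by congr (_ + _); rewrite rmorphM; ring.
Qed.

End mixing_derivative.

(** * Complex Gaussian density with scalar covariance *)

Section gaussian_likelihood.
Context (R : realType) (n : nat).
Implicit Types z mu y : 'cV[R[i]]_n.

Lemma trmxC_scale_real m (a : R) (A : 'M[R[i]]_(n, m)) :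
  ((a%:C *: A) ^t*) = a%:C *: (A ^t*).
Proof.
by apply/matrixP => i j; rewrite !mxE rmorphM; congr (_ * _); exact: conjc_real.
Qed.

Lemma Re_real_mul (a : R) (z : R[i]) : complex.Re (a%:C * z) = a * complex.Re z.
Proof. by case: z => x y /=; rewrite mul0r subr0. Qed.

Definition sqrnorm z : R := complex.Re (((z ^t*) *m z) 0 0).

Lemma sqrnormE z : sqrnorm z = \sum_a tnth (reim z) a ^+ 2.
Proof. by rewrite /sqrnorm Re_trmxC_mul; apply: eq_bigr => a _; rewrite expr2. Qed.

(** The normalizing determinant [(pi s) ^ n] is moved into the exponent, so that the logarithm of a
    product of densities is a plain sum. *)
Lemma cgauss_pdf_scalar mu (s : R) y : 0 < s ->
  cgauss_pdf mu (s%:C%:M) y =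
  expR (- (n%:R * ln (pi * s)) - s^-1 * sqrnorm (y - mu)).
Proof.
move=> s0; have pis : 0 < pi * s by rewrite mulr_gt0// pi_gt0.
rewrite /cgauss_pdf scale_scalar_mx det_scalar -rmorphM -rmorphXn /=.
rewrite expRB expRN expRM_natl lnK ?posrE//.
rewrite -expRN; congr (_ * expR _).
rewrite invmx_scalar mul_mx_scalar -scalemxAl mxE /sqrnorm -fmorphV.
by case: (_ 0 0) => a b /=; rewrite mul0r subr0.
Qed.

Lemma is_derive_reim (g : R -> 'cV[R[i]]_n) (l : 'cV[R[i]]_n) a :
  (forall m, is_cderive (fun r => g r m 0) (l m 0)) ->
  is_derive (0 : R) 1 (fun r => tnth (reim (g r)) a) (tnth (reim l) a).
Proof.
move=> gl; rewrite -[a]splitK; case: (fintype.split a) => i /=.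
- under eq_fun do rewrite reim_lshift.
  by rewrite reim_lshift; case: (gl i).
- under eq_fun do rewrite reim_rshift.
  by rewrite reim_rshift; case: (gl i).
Qed.

Lemma reimD z y a : tnth (reim (z + y)) a = tnth (reim z) a + tnth (reim y) a.
Proof.
by rewrite -[a]splitK; case: (fintype.split a) => i /=;
  rewrite ?reim_lshift ?reim_rshift mxE ?ReD ?ImD.
Qed.

Lemma is_derive_sqrnorm (mu : R -> 'cV[R[i]]_n) (l : 'cV[R[i]]_n) y :
  (forall m, is_cderive (fun r => mu r m 0) (l m 0)) ->
  is_derive (0 : R) 1 (fun r => sqrnorm (y - mu r))
    (- (2 * complex.Re (((l ^t*) *m (y - mu 0)) 0 0))).
Proof.
move=> mul.
pose e a r := tnth (reim (y - mu r)) a.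
have de a : is_derive (0 : R) 1 (e a) (- tnth (reim l) a).
  have H := is_deriveB (is_derive_cst (tnth (reim y) a) (0 : R) (1 : R))
    (is_derive_reim a mul).
  rewrite sub0r in H.
  rewrite (_ : e a = cst (tnth (reim y) a) - fun r => tnth (reim (mu r)) a)//.
  by apply/funext => r; rewrite /e reimD reim_oppr.
have H := is_derive_sum (fun a => is_deriveM (de a) (de a)).
rewrite (_ : (fun r => _) = \sum_a (e a * e a)); last first.
  by apply/funext => r; rewrite sqrnormE fct_sumE; apply: eq_bigr => a _; rewrite expr2.
apply: (is_derive_eq H).
rewrite Re_trmxC_mul mulr_sumr -sumrN; apply: eq_bigr => a _.
by rewrite /e /GRing.scale /=; ring.
Qed.

End gaussian_likelihood.

(** * Directional score at the true parameter *)

Section score.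
Context (R : realType) (M K P N : nat) (p : 'I_M -> R) (B : 'M[R[i]]_(P, K)).
Context (s2 : R) (S : 'I_N -> 'cV[R[i]]_K) (phi : 'rV[R]_K).
Hypothesis s20 : 0 < s2.
Local Notation theta := (pack s2 S phi).
Implicit Types h : 'rV[R]_(nparam K N).

Lemma param_var_line (r : R) h t :
  param_var (r *: h + t) = r * param_var h + param_var t.
Proof. by rewrite /param_var !mxE. Qed.

Lemma param_phi_line (r : R) h t :
  param_phi (r *: h + t) = r *: param_phi h + param_phi t.
Proof. by rewrite /param_phi linearP. Qed.

Lemma param_sig_line (r : R) h t f :
  param_sig (r *: h + t) f = r%:C *: param_sig h f + param_sig t f.
Proof.
rewrite /param_sig; apply/matrixP => k j; rewrite !linearP !mxE.
by apply/eqP; rewrite eq_complex /= !mul0r subr0 addr0 !eqxx.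
Qed.

(** This is [J_h(f)], the derivative of the noiseless observation in the direction [h]. *)
Definition score_diff h f : 'cV[R[i]]_(M * P) :=
  mean_diff p B phi (param_phi h) (S f) (param_sig h f).

(** The variance acts through the log-determinant and through the inverse factor, the mean through
    the squared norm; the two contributions add up. *)
Lemma is_derive_log_lik h (y : 'cV[R[i]]_(M * P)) f :
  let v := param_var h in
  let e := y - mixing_mx p B phi *m S f in
  is_derive (0 : R) 1 (fun r => - ((M * P)%:R * ln (pi * (r * v + s2)))
     - (r * v + s2)^-1 *
       sqrnorm (y - mixing_mx p B (r *: param_phi h + phi) *m
                    (r%:C *: param_sig h f + S f)))
  (v * (- ((M * P)%:R / s2) + (s2 ^+ 2)^-1 * sqrnorm e)
   + 2 / s2 * complex.Re (((score_diff h f ^t*) *m e) 0 0)).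
Proof.
move=> v e.
have daff := is_derive_affine v s2.
have aff0 : 0 * v + s2 = s2 by rewrite mul0r add0r.
have pis : 0 < pi * s2 by rewrite mulr_gt0// pi_gt0.
have dpi : is_derive (0 : R) 1 (fun r => pi * (r * v + s2)) (pi * v).
  exact: (is_deriveZ pi daff).
have dln : is_derive (0 : R) 1 (fun r => ln (pi * (r * v + s2))) (v / s2).
  have dl : is_derive (pi * (0 * v + s2)) 1 (@ln R) (pi * s2)^-1.
    by rewrite aff0; exact: is_derive1_ln.
  have H := @is_derive1_comp _ _ (fun r : R => pi * (r * v + s2)) 0 _ _ dl dpi.
  apply: (is_derive_eq H).
  have pi0 : pi != 0 :> R by rewrite gt_eqF// pi_gt0.
  have s2n : s2 != 0 by rewrite gt_eqF.
  by move: (pi : R) pi0 => q q0; field; rewrite q0 s2n.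
have dinv : is_derive (0 : R) 1 (fun r => (r * v + s2)^-1) (- v / s2 ^+ 2).
  have ne : 0 * v + s2 != 0 by rewrite aff0 gt_eqF.
  have H := @is_deriveV R (fun r : R => r * v + s2) 0 v 1 ne daff.
  apply: (is_derive_eq H).
  by rewrite aff0 /GRing.scale /=; field; rewrite gt_eqF.
have dn := is_derive_sqrnorm y (is_cderive_mean p B phi (param_phi h) (S f) (param_sig h f)).
have H := is_deriveB (is_deriveN (is_deriveZ (M * P)%:R dln)) (is_deriveM dinv dn).
apply: (is_derive_eq H).
rewrite /= !scale0r !add0r -/e -/(score_diff h f) aff0.
by rewrite /GRing.scale /=; field; rewrite gt_eqF.
Qed.

Lemma score_pack h (w : 'I_N -> 'cV[R[i]]_(M * P)) :
  'D_h (fun t => ln (likelihood p B t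
          (fun f => mixing_mx p B phi *m S f + w f))) theta =
  param_var h * (- (N%:R * (M * P)%:R / s2) + (s2 ^+ 2)^-1 * \sum_f sqrnorm (w f))
  + \sum_f complex.Re ((((2 / s2)%:C *: score_diff h f) ^t* *m w f) 0 0).
Proof.
apply: derive_line.
pose v := param_var h.
pose L f r := - ((M * P)%:R * ln (pi * (r * v + s2)))
     - (r * v + s2)^-1 *
       sqrnorm (mixing_mx p B phi *m S f + w f -
                mixing_mx p B (r *: param_phi h + phi) *m
                    (r%:C *: param_sig h f + S f)).
(* The density formula requires a positive variance, which along the line is guaranteed only for [r]
   near 0; this suffices for the derivative there. *)
have pos : \forall r \near (0 : R), 0 < r * v + s2.
  have c : (r * v + s2) @[r --> (0 : R)] --> 0 * v + s2.
    by apply: cvgD; [apply: cvgM; [exact: cvg_id|exact: cvg_cst]|exact: cvg_cst].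
  have q : 0 < 0 * v + s2 by rewrite mul0r add0r.
  exact: (@cvgr_gt R _ _ _ _ _ c _ q).
apply: (@near_eq_is_derive _ _ _ (\sum_f L f)).
  near=> r.
  have r0 : 0 < r * v + s2 by near: r.
  rewrite /likelihood param_var_line param_phi_line param_var_pack param_phi_pack.
  under [in RHS]eq_bigr => f _.
    rewrite param_sig_line param_sig_pack cgauss_pdf_scalar//; over.
  by rewrite -expR_sum expRK fct_sumE.
have H := is_derive_sum (fun f => is_derive_log_lik h (mixing_mx p B phi *m S f + w f) f).
apply: (is_derive_eq H).
rewrite big_split /= -mulr_sumr; congr (_ + _).
  congr (_ * _); rewrite big_split /= -mulr_sumr sumr_const card_ord; congr (_ + _).
    by rewrite -[LHS]mulr_natl mulrN mulrA.
  by congr (_ * _); apply: eq_bigr => f _; rewrite addrAC subrr add0r.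
apply: eq_bigr => f _; rewrite addrAC subrr add0r.
by rewrite trmxC_scale_real -scalemxAl [X in _ = complex.Re X]mxE Re_real_mul.
Unshelve. all: by end_near.
Qed.

End score.

(** * The Fisher information matrix and its inverse *)

Section complex_least_squares.
Context (R : realType).

Lemma trmxC_mul m n k (A : 'M[R[i]]_(m, n)) (B : 'M[R[i]]_(n, k)) :
  ((A *m B) ^t*) = (B ^t*) *m (A ^t*).
Proof. by rewrite trmx_mul map_mxM. Qed.

Lemma trmxC_add m n (A B : 'M[R[i]]_(m, n)) :
  ((A + B) ^t*) = (A ^t*) + (B ^t*).
Proof. by rewrite linearD /= map_mxD. Qed.

Lemma trmxC_opp m n (A : 'M[R[i]]_(m, n)) : ((- A) ^t*) = - (A ^t*).
Proof. by rewrite linearN /= map_mxN. Qed.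

Lemma sqrnorm_ge0 n (z : 'cV[R[i]]_n) : 0 <= sqrnorm z.
Proof. by rewrite sqrnormE sumr_ge0// => a _; rewrite sqr_ge0. Qed.

Lemma sqrnorm_eq0 n (z : 'cV[R[i]]_n) : sqrnorm z = 0 -> z = 0.
Proof.
rewrite sqrnormE => /eqP; rewrite psumr_eq0 => [|a _]; last exact: sqr_ge0.
move=> /allP z0; apply/matrixP => i j; rewrite (ord1 j) mxE.
have /= := z0 (lshift n i) (mem_index_enum _); rewrite sqrf_eq0 reim_lshift => re.
have /= := z0 (rshift n i) (mem_index_enum _); rewrite sqrf_eq0 reim_rshift => im.
by apply/eqP; rewrite eq_complex/= re im.
Qed.

Context (m n : nat) (G : 'M[R[i]]_(m, n)).
Hypothesis rG : \rank G = n.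

Lemma full_col_rank_inj (z : 'cV[R[i]]_n) : G *m z = 0 -> z = 0.
Proof.
move=> /(congr1 trmx); rewrite trmx_mul trmx0 => /eqP.
rewrite mulmx_free_eq0; last by rewrite /row_free mxrank_tr rG.
by move=> /eqP /(congr1 trmx); rewrite trmxK trmx0.
Qed.

(** If [u] is in the left kernel, then [u G^H G u^H = 0] is the squared norm of [G u^H], and
    injectivity of [G] forces [u = 0]. *)
Lemma gram_unitmx : (G ^t*) *m G \in unitmx.
Proof.
rewrite -row_free_unit -kermx_eq0; apply/eqP/row_matrixP => i.
rewrite row0; set u := row i _.
have uG : u *m ((G ^t*) *m G) = 0 by apply/sub_kermxP; exact: row_sub.
have : G *m (u ^t*) = 0.
  apply: sqrnorm_eq0; rewrite /sqrnorm trmxC_mul trmxCK.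
  by rewrite mulmxA -(mulmxA u) uG mul0mx mxE.
move=> /full_col_rank_inj /(congr1 (fun A => A ^t*)).
by rewrite trmxCK => ->; apply/matrixP => a b; rewrite !mxE conjC0.
Qed.

Lemma proj_perp_mulG : proj_perp G *m G = 0.
Proof.
rewrite /proj_perp mulmxBl mul1mx /gram_pinv -!mulmxA mulVmx ?gram_unitmx//.
by rewrite mulmx1 subrr.
Qed.

Lemma trmxC_proj_perp : ((proj_perp G) ^t*) = proj_perp G.
Proof.
rewrite /proj_perp /gram_pinv trmxC_add trmxC_opp.
rewrite !trmxC_mul trmxCK -mulmxA; congr (_ - _).
  by rewrite trmx1 map_mx1.
congr (_ *m (_ *m _)).
rewrite trmx_inv map_invmx -/(_ ^t*); congr invmx.
by rewrite trmxC_mul trmxCK.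
Qed.

End complex_least_squares.

(** * Decomposition of parameter directions *)

Section packing.
Context (R : realType) (K N : nat).

Lemma pack_params (t : 'rV[R]_(nparam K N)) :
  pack (param_var t) (param_sig t) (param_phi t) = t.
Proof.
rewrite /pack /param_var /param_phi -[RHS](hsubmxK t); congr row_mx.
rewrite -[RHS](hsubmxK (lsubmx t)); congr row_mx.
  by rewrite -mx11_scalar.
set ri := rsubmx _; rewrite -[RHS](hsubmxK ri).
congr row_mx.
- rewrite -[RHS]vec_mxK; congr mxvec; apply/matrixP => k f.
  by rewrite !mxE.
- rewrite -[RHS]vec_mxK; congr mxvec; apply/matrixP => k f.
  by rewrite !mxE.
Qed.

Lemma row_linear_sum n (g : 'rV[R]_n -> R) (u : 'rV[R]_n) :
  (forall r x y, g (r *: x + y) = r * g x + g y) ->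
  g u = \sum_i u 0 i * g (delta_mx 0 i).
Proof.
move=> gP.
have g0 : g 0 = 0 by have := gP (-1) 0 0; rewrite scaler0 addr0 => ->; rewrite mulN1r addNr.
rewrite {1}[u]row_sum_delta; elim: (index_enum _) => [|i s IH].
  by rewrite !big_nil.
by rewrite !big_cons gP IH.
Qed.

End packing.

(** * The bilinear form given by the covariance of scores *)

Section score_form.
Context (R : realType) (n N m : nat) (v : 'rV[R]_n -> R).
Context (J : 'rV[R]_n -> 'I_N -> 'cV[R[i]]_m) (k q : R).

Definition score_form h h' : R := v h * v h' * k +
  q * \sum_f complex.Re (((J h f) ^t* *m J h' f) 0 0).

Lemma score_form_sym h h' : score_form h h' = score_form h' h.
Proof.
rewrite /score_form [v h' * v h]mulrC; congr (_ + _ * _).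
apply: eq_bigr => f _; rewrite !Re_trmxC_mul.
by apply: eq_bigr => a _; rewrite mulrC.
Qed.

Hypothesis v_line : forall (r : R) h h', v (r *: h + h') = r * v h + v h'.
Hypothesis J_line :
  forall (r : R) h h' f, J (r *: h + h') f = r%:C *: J h f + J h' f.

Lemma score_form_linel h' (r : R) h1 h2 :
  score_form (r *: h1 + h2) h' = r * score_form h1 h' + score_form h2 h'.
Proof.
have -> : score_form (r *: h1 + h2) h' = (r * v h1 + v h2) * v h' * k +
    q * \sum_f (r * complex.Re (((J h1 f) ^t* *m J h' f) 0 0) +
                complex.Re (((J h2 f) ^t* *m J h' f) 0 0)).
  rewrite /score_form v_line; congr (_ + _ * _); apply: eq_bigr => f _.
  rewrite J_line trmxC_add trmxC_scale_real.
  by rewrite mulmxDl -scalemxAl mxE [X in X + _]mxE ReD Re_real_mul.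
by rewrite big_split /= -mulr_sumr /score_form; ring.
Qed.

End score_form.

(** * Inverting the information matrix *)

Section information.
Context (R : realType) (M K P N : nat) (p : 'I_M -> R) (B : 'M[R[i]]_(P, K)).
Context (S : 'I_N -> 'cV[R[i]]_K) (phi : 'rV[R]_K) (s2 kappa : R).
Hypothesis s20 : 0 < s2.
Hypothesis kappa0 : 0 < kappa.
Hypothesis N0 : (0 < N)%N.
Local Notation G := (mixing_mx p B phi).
Local Notation E := (dmixing_mx p B phi).
Local Notation PG := (proj_perp G).
Local Notation H := (Remx (hadamard ((E ^t*) *m PG *m E) ((sample_cov S)^T))).
Hypothesis rG : \rank G = K.
Hypothesis uH : H \in unitmx.

Local Notation J := (score_diff p B S phi).
Implicit Types (h : 'rV[R]_(nparam K N)) (psi : 'rV[R]_K).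

Let Ed psi f := E *m (diag_mx (map_mx (real_complex R) psi) *m S f).

Lemma score_diffE h f : J h f = G *m param_sig h f + Ed (param_phi h) f.
Proof. by []. Qed.

Lemma score_diff_line (r : R) h h' f : J (r *: h + h') f = r%:C *: J h f + J h' f.
Proof.
rewrite !score_diffE param_sig_line param_phi_line /Ed.
rewrite map_mxD map_mxZ mulmxDr -scalemxAr [diag_mx _]linearP /= mulmxDl.
by rewrite -scalemxAl mulmxDr -scalemxAr scalerDr addrACA.
Qed.

(** The factor [2 / s2] is the squared score coefficient [(2 / s2) ^ 2] times the variance [s2 / 2]
    of a real noise coordinate. *)
Definition info : 'rV[R]_(nparam K N) -> 'rV[R]_(nparam K N) -> R :=
  score_form (@param_var R K N) J kappa (2 / s2).

Lemma info_linel h' (r : R) h1 h2 :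
  info (r *: h1 + h2) h' = r * info h1 h' + info h2 h'.
Proof.
apply: score_form_linel => [a x y|a x y f]; first exact: param_var_line.
exact: score_diff_line.
Qed.

Lemma info_sym h h' : info h h' = info h' h.
Proof. exact: score_form_sym. Qed.

Lemma mul_info_mx_row h j : \sum_i h 0 i * info (delta_mx 0 i) (delta_mx 0 j) =
  info h (delta_mx 0 j).
Proof. by rewrite [RHS](row_linear_sum h (info_linel _)). Qed.

Definition info_mx : 'M[R]_(nparam K N) :=
  \matrix_(i, j) info (delta_mx 0 i) (delta_mx 0 j).

Lemma mul_info_mx h j : (h *m info_mx) 0 j = info h (delta_mx 0 j).
Proof.
rewrite -mul_info_mx_row mxE.
by apply: eq_bigr => i _; rewrite mxE.
Qed.

(** Expanding gives the terms [psi_k psi'_l Q_kl S_l conj(S_k)]. Summing over the snapshots turns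
    [S_l conj(S_k)] into [N] times the entry [(l, k)] of the sample covariance, which is why its
    transpose stands in [H]. *)
Lemma projected_information psi psi' :
  \sum_f complex.Re (((Ed psi f) ^t* *m (PG *m Ed psi' f)) 0 0) =
  N%:R * (psi *m H *m psi'^T) 0 0.
Proof.
pose Q := (E ^t*) *m PG *m E.
have term f : complex.Re (((Ed psi f) ^t* *m (PG *m Ed psi' f)) 0 0) =
    \sum_l \sum_k psi 0 k * psi' 0 l *
      complex.Re (Q k l * (S f *m ((S f) ^t*)) l k).
  have -> : (Ed psi f) ^t* *m (PG *m Ed psi' f) =
      ((diag_mx (map_mx (real_complex R) psi) *m S f) ^t*) *m
      (Q *m (diag_mx (map_mx (real_complex R) psi') *m S f)).
    by rewrite /Ed /Q trmxC_mul !mulmxA.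
  rewrite mulmxA mxE Re_sum; apply: eq_bigr => l _.
  rewrite [X in X * _]mxE mulr_suml Re_sum; apply: eq_bigr => k _.
  rewrite !mul_diag_mx; move: (Q k l) => q.
  rewrite !mxE big_ord1 !mxE.
  by case: (S f k 0) (S f l 0) q => a b [c e] [q1 q2] /=; ring.
under eq_bigr => f _ do rewrite term.
rewrite exchange_big /= mxE mulr_sumr; apply: eq_bigr => l _.
rewrite exchange_big /= mxE mulr_suml mulr_sumr; apply: eq_bigr => k _.
rewrite -mulr_sumr -Re_sum -mulr_sumr.
have -> : \sum_f (S f *m ((S f) ^t*)) l k = N%:R%:C * (sample_cov S) l k.
  rewrite /sample_cov mxE summxE mulrA.
  have -> : N%:R%:C * N%:R^-1 = 1 :> R[i].
    by rewrite rmorph_nat mulfV// pnatr_eq0 -lt0n.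
  by rewrite mul1r.
have -> : H k l = complex.Re (Q k l * sample_cov S l k).
  by rewrite [LHS]mxE [X in complex.Re X]mxE [X in _ * X]mxE.
rewrite mulrCA Re_real_mul [psi'^T _ _]mxE.
by ring.
Qed.

Let X := (s2 / (2 * N%:R)) *: invmx H.

(** The signal part is minus the least-squares fit of [Ed] by the columns of [G], so the derivative
    of the mean is a residual orthogonal to those columns; the zero variance part removes the
    [kappa] term. *)
Lemma info_efficient k h :
  info (pack 0 (fun f => - (gram_pinv G *m Ed (row k X) f)) (row k X)) h =
  param_phi h 0 k.
Proof.
set z := pack _ _ _.
have Jz f : J z f = PG *m Ed (row k X) f.
  rewrite score_diffE /z param_sig_pack param_phi_pack mulmxN mulmxA addrC.
  by rewrite /proj_perp mulmxBl mul1mx.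
rewrite /info /score_form {1}/z param_var_pack 2!mul0r add0r.
under eq_bigr => f _.
  rewrite Jz trmxC_mul trmxC_proj_perp score_diffE mulmxDr.
  rewrite -!mulmxA (mulmxA PG G) (proj_perp_mulG rG) mul0mx mulmx0 add0r.
  over.
(* The scale of [X] is chosen to cancel the factor [2 / s2] of the form and the factor [N] of
   [projected_information]. *)
have XH : X *m H = (s2 / (2 * N%:R))%:M by rewrite -scalemxAl mulVmx// scalemx1.
rewrite projected_information -row_mul XH rowE mul_mx_scalar -scalemxAl -rowE.
rewrite !mxE; field.
by rewrite pnatr_eq0 -lt0n N0 gt_eqF.
Qed.

(** The form is positive definite. For a kernel vector both nonnegative terms vanish: the variance
    part is zero, projecting [J u = 0] off the range of [G] leaves [H] applied to the [phi] part,
    and injectivity of [G] then removes the signal part. *)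
Lemma info_mx_unit : info_mx \in unitmx.
Proof.
rewrite -row_free_unit -kermx_eq0; apply/eqP/row_matrixP => i.
rewrite row0; set u := row i _.
have uF : u *m info_mx = 0 by apply/sub_kermxP; exact: row_sub.
have uQ h : info u h = 0.
  rewrite info_sym (row_linear_sum h (info_linel u)); apply: big1 => j _.
  by rewrite info_sym -mul_info_mx uF mxE mulr0.
have := uQ u; rewrite /info /score_form => /eqP.
have J0 : 0 <= 2 / s2 * \sum_f sqrnorm (J u f).
  by rewrite mulr_ge0 ?divr_ge0 ?(ltW s20)// sumr_ge0// => f _; exact: sqrnorm_ge0.
rewrite paddr_eq0//; last by rewrite mulr_ge0 ?(ltW kappa0)// -expr2 sqr_ge0.
rewrite mulf_eq0 (gt_eqF kappa0) orbF -expr2 sqrf_eq0 => /andP[/eqP v0].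
rewrite mulf_eq0 gt_eqF ?divr_gt0//= psumr_eq0 => [|f _]; last exact: sqrnorm_ge0.
move=> /allP J0f.
have {}J0f f : J u f = 0.
  by apply: sqrnorm_eq0; apply/eqP; exact: (J0f f (mem_index_enum _)).
have PE f : PG *m Ed (param_phi u) f = 0.
  have := congr1 (mulmx PG) (J0f f).
  by rewrite score_diffE mulmxDr mulmxA (proj_perp_mulG rG) mul0mx add0r mulmx0.
have phi0 : param_phi u = 0.
  (* Pairing with each unit direction reads off one entry of the product at a time. *)
  have Hphi : H *m (param_phi u)^T = 0.
    apply/matrixP => k j; rewrite (ord1 j) [RHS]mxE.
    have := projected_information (delta_mx 0 k) (param_phi u).
    rewrite big1 => [|f _]; last by rewrite PE mulmx0 mxE.
    move=> /esym/eqP; rewrite mulf_eq0 pnatr_eq0 gtn_eqF//= => /eqP.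
    by rewrite -mulmxA -rowE mxE.
  by apply: trmx_inj; rewrite trmx0 -[LHS](mulKmx uH) Hphi mulmx0.
have sig0 f : param_sig u f = 0.
  apply: (full_col_rank_inj rG); have := J0f f; rewrite score_diffE phi0 /Ed.
  by rewrite map_mx0 linear0 mul0mx mulmx0 addr0.
rewrite -(pack_params u) v0 phi0.
have -> : param_sig u = fun=> 0 by apply/funext.
rewrite -[RHS]pack_params; congr pack.
- by rewrite /param_var !mxE.
- apply/funext => f; apply/matrixP => k l.
  by rewrite /param_sig !mxE.
- by rewrite /param_phi linear0.
Qed.

(** The efficient directions, stacked as rows of [Z], satisfy [Z F = [0 I]]. So [Z] is the last
    block of rows of the inverse, and its [phi] columns are [X]. *)
Lemma crb_phi_info_mx : crb_phi info_mx = X.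
Proof.
pose Z := \matrix_k pack 0 (fun f => - (gram_pinv G *m Ed (row k X) f)) (row k X).
have ZF : Z *m info_mx = row_mx 0 1%:M.
  apply/row_matrixP => k; rewrite row_mul rowK; apply/rowP => j.
  rewrite mul_info_mx info_efficient /param_phi mxE [RHS]mxE.
  rewrite -[j]splitK; case: (fintype.split j) => l /=.
    by rewrite row_mxEl !mxE eqxx eq_rlshift.
  by rewrite row_mxEr !mxE eqxx eq_rshift.
have ZE : Z = row_mx 0 1%:M *m invmx info_mx.
  by rewrite -ZF mulmxK// info_mx_unit.
transitivity (rsubmx (Z : 'M[R]_(K, 1 + (K * N + K * N) + K))); last first.
  apply/matrixP => k l; rewrite mxE mxE.
  have := param_phi_pack 0 (fun f => - (gram_pinv G *m Ed (row k X) f)) (row k X).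
  by move=> /matrixP/(_ 0 l); rewrite mxE => ->; rewrite mxE.
rewrite ZE /crb_phi; move: (invmx _ : 'M[R]_(1 + (K * N + K * N) + K)) => A.
by rewrite -[A in RHS]submxK mul_row_block row_mxKr mul0mx mul1mx add0r.
Qed.

End information.

(** * From the statistical model to the bound *)

Lemma fisher_information_info_mx (R : realType) (M K P N : nat) (p : 'I_M -> R)
    (B : 'M[R[i]]_(P, K)) (s2 : R) (S : 'I_N -> 'cV[R[i]]_K) (phi : 'rV[R]_K)
    d (W : measurableType d) (Pr : probability W R)
    (w : 'I_N -> W -> 'cV[R[i]]_(M * P)) :
  0 < s2 ->
  (forall f, complex_gaussian Pr (w f)) -> (forall f, zero_mean Pr (w f)) ->
  (forall f, circularly_symmetric Pr (w f)) ->
  (forall f, covariance_mx Pr (w f) = (s2%:C)%:M) ->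
  independent_cvecs Pr w ->
  fisher_information Pr (likelihood p B)
    (fun t f => mixing_mx p B phi *m S f + w f t) (pack s2 S phi) =
  info_mx p B S phi s2 (mean Pr (fun t => (- (N%:R * (M * P)%:R / s2) +
    (s2 ^+ 2)^-1 * \sum_f complex.Re (((w f t ^t*) *m w f t) 0 0)) ^+ 2)).
Proof.
move=> s20 gw mw cw covw iw; apply/matrixP => i j; rewrite !mxE /info.
under [in LHS]eq_fun => t.
  rewrite !(score_pack p B S phi s20 _ (fun f => w f t)); over.
rewrite -/(mean _ _) (mean_score_product gw mw cw covw iw).
congr (_ + _); rewrite !mulr_sumr; apply: eq_bigr => f _.
rewrite trmxC_scale_real -scalemxAl -scalemxAr scalerA mxE -rmorphM Re_real_mul.
by field; rewrite gt_eqF.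
Qed.

Lemma Remx_hadamard_scale (R : realType) (m n : nat) (a : R)
    (Q : 'M[R[i]]_(m, n)) (A : 'M[R[i]]_(n, m)) :
  Remx (hadamard Q ((a%:C *: A)^T)) = a *: Remx (hadamard Q (A^T)).
Proof. by apply/matrixP => k l; rewrite !mxE mulrCA Re_real_mul. Qed.

Theorem mainTheorem1 (R : realType) (M K P L N : nat) (T : R)
    (* array *)
    (hKM : (K < M)%N) (p : 'I_M -> R)
    (* multi-coset sampling and occupied sub-bands *)
    (hP : (1 <= P)%N) (hPL : (P <= L)%N) (c : 'I_P -> nat)
    (hc : forall i j : 'I_P, (i < j)%N -> (c i < c j)%N)
    (hcL : forall i : 'I_P, (c i <= L - 1)%N)
    (Omega : 'I_K -> 'I_L) (hOmega : injective Omega)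
    (* N = T / L *)
    (hN : (0 < N)%N) (hT : N%:R = T / L%:R)
    (* unknown parameters *)
    (sigma2 : R) (hsigma2 : 0 < sigma2)
    (S : 'I_N -> 'cV[R[i]]_K) (phi : 'rV[R]_K)
    (* noise *)
    (d : measure_display) (W : measurableType d) (Pr : probability W R)
    (w : 'I_N -> W -> 'cV[R[i]]_(M * P))
    (hgauss : forall f, complex_gaussian Pr (w f))
    (hmean : forall f, zero_mean Pr (w f))
    (hcirc : forall f, circularly_symmetric Pr (w f))
    (hcov : forall f, covariance_mx Pr (w f) = (sigma2%:C)%:M)
    (hindep : independent_cvecs Pr w) :
  let BOmega := colsub Omega (coset_mx R L c) in
  let G := mixing_mx p BOmega phi in
  let E := dmixing_mx p BOmega phi in
  let PG := proj_perp G in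
  let RSbar := sample_cov S in
  let RS := L%:R^-1 *: RSbar in
  let Y := fun (t : W) (f : 'I_N) => G *m S f + w f t in
  let FIM := fisher_information Pr (likelihood p BOmega) Y
               (pack sigma2 S phi) in
  \rank G = K ->
  (* RSbar is Hermitian, so that its conjugate transpose is RSbar itself; the
     matrix that occurs in the Fisher information is the transpose. *)
  Remx (hadamard ((E ^t*) *m PG *m E) (RSbar ^T)) \in unitmx ->
  [/\ FIM \in unitmx,
      crb_phi FIM
      = (sigma2 / (2 * T / L%:R))
        *: invmx (Remx (hadamard ((E ^t*) *m PG *m E) (RSbar ^T))) &
      crb_phi FIM
      = (sigma2 / (2 * T))
        *: invmx (Remx (hadamard ((E ^t*) *m PG *m E) (RS ^T)))].
Proof.
move=> BOmega G E PG RSbar RS Y FIM rG uH.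
have n0 : (0 < M * P)%N by rewrite muln_gt0 hP (leq_ltn_trans _ hKM).
have Ln : L%:R != 0 :> R by rewrite pnatr_eq0 -lt0n (leq_trans hP).
have Nn : N%:R != 0 :> R by rewrite pnatr_eq0 -lt0n.
have hTN : T = N%:R * L%:R by rewrite hT mulfVK.
rewrite /FIM /Y /G fisher_information_info_mx//; set kappa := mean _ _.
(* As the mean of a square it is nonnegative, and the noise energy is not almost surely constant. *)
have kappa0 : 0 < kappa.
  rewrite lt_neqAle eq_sym.
  rewrite (mean_noise_energy_neq0 hgauss hmean hcirc hcov) ?invr_gt0 ?exprn_gt0//=.
  by rewrite fine_ge0// expectation_ge0// => t; exact: sqr_ge0.
have crb := crb_phi_info_mx hsigma2 kappa0 hN rG uH.
(* The factor [1 / L] becomes [L] after inversion, which turns [sigma2 / (2 T)] into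
   [sigma2 / (2 T / L)], with [T / L = N]. *)
have RSE : Remx (hadamard ((E ^t*) *m PG *m E) (RS ^T)) =
    L%:R^-1 *: Remx (hadamard ((E ^t*) *m PG *m E) (RSbar ^T)).
  have LC : L%:R^-1 = (L%:R^-1 : R)%:C :> R[i] by rewrite fmorphV rmorph_nat.
  by rewrite /RS LC Remx_hadamard_scale.
split; first exact: info_mx_unit.
- rewrite crb hTN; congr (_ *: _); field.
  by rewrite Ln Nn.
- rewrite crb RSE invmxZ; last by rewrite unitmxZ// unitfE invr_eq0.
  rewrite scalerA invrK hTN; congr (_ *: _); field.
  by rewrite Ln Nn.
Qed.
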